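(* Let $(\Omega,T)$ be a topological dynamical system ($\Omega$ a compact metric space, $T:\Omega\to\Omega$ a homeomorphism), let $m\ge 1$, $C\in \mathrm{GL}(m,\mathbb{C})$, and let $V:\Omega\to \mathrm{Her}(m,\mathbb{C})$ be continuous. Let $H_{V,T,\omega}$ be the associated Schrödinger operators on the strip and $(T,A_E)$ the associated Schrödinger cocycles. Let $J\subset\mathbb{R}$ be a set of energies such that $(T,A_E)$ is partially hyperbolic, with splitting $\mathbb{C}^{2m}=E^u_{A_E}\oplus E^c_{A_E}\oplus E^s_{A_E}$, for every $E\in J$. Then for all $\omega\in\Omega$, the operator $H_{V,T,\omega}$ is purely absolutely continuous on $$\mathcal{B}_\omega:=\Big\{E\in J:\ \sup_{n\in\mathbb{Z}}\big\|(A_E)_n(\omega)|_{E^c_{A_E}(\omega)}\big\|<\infty\Big\}.$$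
   Context: $\mathrm{Her}(m,\mathbb{C})$ is the space of $m\times m$ Hermitian matrices. For $\omega\in\Omega$, $H_{V,T,\omega}$ acts on $\ell^2(\mathbb{Z},\mathbb{C}^m)$ by $$(H_{V,T,\omega}\vec u)_n=C\vec u_{n+1}+V(T^n\omega)\vec u_n+C^*\vec u_{n-1}.$$ The Schrödinger cocycle at energy $E$ is $(\omega,v)\mapsto (T\omega,A_E(\omega)v)$ on $\Omega\times\mathbb{C}^{2m}$ with $$A_E(\omega)=\begin{pmatrix} C^{-1}(EI-V(\omega)) & -C^{-1}C^*\\ I&0\end{pmatrix}.$$ Iterates: $(A_E)_0=I$, $(A_E)_n(\omega)=A_E(T^{n-1}\omega)\cdots A_E(\omega)$ for $n\ge1$, $(A_E)_{-n}(\omega)=(A_E)_n(T^{-n}\omega)^{-1}$. $(T,A_E)$ is partially hyperbolic if there is a continuous, $A_E$-invariant splitting $\mathbb{C}^{2m}=E^u_{A_E}(\omega)\oplus E^c_{A_E}(\omega)\oplus E^s_{A_E}(\omega)$ (any of the three bundles is allowed to be trivial) which is dominated (there is $N\ge1$ such that for every $\omega$ and all unit vectors $v,v'$ belonging respectively to two consecutive nontrivial bundles in the order $E^u,E^c,E^s$ at $\omega$, $\|(A_E)_N(\omega)v\|>\|(A_E)_N(\omega)v'\|$), and there are constants $K,c>0$ such that for all $n\ge0$: $\|(A_E)_n(\omega)v\|\le Ke^{-cn}\|v\|$ for $v\in E^s_{A_E}(\omega)$, and $\|(A_E)_n(\omega)^{-1}v\|\le Ke^{-cn}\|v\|$ for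 $v\in E^u_{A_E}(T^n\omega)$. ''Purely absolutely continuous on a set $B$'' means that the singular part of every spectral measure of $H_{V,T,\omega}$ gives zero mass to $B$. *)

(* Defs.v *)
From HB Require Import structures.
From mathcomp Require Import all_boot all_order all_algebra.
From mathcomp Require Import complex.
From mathcomp Require Import all_classical all_reals all_analysis.

Set Implicit Arguments.
Unset Strict Implicit.
Unset Printing Implicit Defensive.

Import Order.TTheory GRing.Theory Num.Theory.
Import numFieldNormedType.Exports.

Local Open Scope classical_set_scope.
Local Open Scope ring_scope.
Local Open Scope complex_scope.
Local Open Scope sesquilinear_scope.

(* R[i] packaged as a numClosedFieldType, so that the topology which
   MathComp-Analysis puts on every such type (and on matrices over it) is
   available. *)
Definition Cx (R : realType) : numClosedFieldType := R[i].

Definition dotc (R : realType) (k : nat) (u v : 'cV[Cx R]_k) : Cx R :=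
  \sum_(i < k) (u i 0)^* * v i 0.

Definition vnorm (R : realType) (k : nat) (v : 'cV[Cx R]_k) : R :=
  Num.sqrt (\sum_(i < k) (complex.Re `|v i 0|) ^+ 2).

Section dynamics.
Context (R : realType) (Omega : metricType R) (T Tinv : Omega -> Omega).

Definition is_homeomorphism : Prop :=
  [/\ continuous T, continuous Tinv, cancel T Tinv & cancel Tinv T].

Definition iterz (n : int) (w : Omega) : Omega :=
  match n with
  | Posz k => iter k T w
  | Negz k => iter k.+1 Tinv w
  end.

Context (d : nat) (A : Omega -> 'M[Cx R]_d).

Fixpoint cocycle_nat (n : nat) (w : Omega) : 'M[Cx R]_d :=
  match n with
  | 0%N => 1%:M
  | k.+1 => A (iter k T w) *m cocycle_nat k w
  end.

Definition cocycle (n : int) (w : Omega) : 'M[Cx R]_d :=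
  match n with
  | Posz k => cocycle_nat k w
  | Negz k => invmx (cocycle_nat k.+1 (iterz (Negz k) w))
  end.

(* Continuity into the Grassmannian, i.e. of the orthogonal projector onto the
   fibre. *)
Definition continuous_bundle (F : Omega -> {vspace 'cV[Cx R]_d}) : Prop :=
  exists2 P : Omega -> 'M[Cx R]_d, continuous P &
    forall w, [/\ (P w)^t* = P w, P w *m P w = P w &
                  forall v, v \in F w <-> P w *m v = v].

(* For invertible A this is A(w) F(w) = F(T w). *)
Definition invariant_bundle (F : Omega -> {vspace 'cV[Cx R]_d}) : Prop :=
  forall w v, (v \in F w) <-> (A w *m v \in F (T w)).

Definition dominates_at (N : nat) (w : Omega) (F G : {vspace 'cV[Cx R]_d}) :
    Prop :=
  forall v v', v \in F -> v' \in G -> vnorm v = 1 -> vnorm v' = 1 ->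
    vnorm (cocycle_nat N w *m v') < vnorm (cocycle_nat N w *m v).

(* Eu and Es are consecutive exactly where Ec is trivial; the condition on a
   pair with a trivial member is void since 0 has no unit vector. *)
Definition dominated_splitting (Eu Ec Es : Omega -> {vspace 'cV[Cx R]_d}) :
    Prop :=
  exists2 N : nat, (1 <= N)%N &
    forall w, [/\ dominates_at N w (Eu w) (Ec w),
                  dominates_at N w (Ec w) (Es w) &
                  Ec w = 0%VS -> dominates_at N w (Eu w) (Es w)].

Definition partially_hyperbolic (Eu Ec Es : Omega -> {vspace 'cV[Cx R]_d}) :
    Prop :=
  [/\ forall w, directv (Eu w + Ec w + Es w) /\
                (Eu w + Ec w + Es w)%VS = fullv,
      [/\ continuous_bundle Eu, continuous_bundle Ec & continuous_bundle Es],
      [/\ invariant_bundle Eu, invariant_bundle Ec & invariant_bundle Es],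
      dominated_splitting Eu Ec Es &
      exists K c : R, [/\ 0 < K, 0 < c &
        forall (n : nat) w,
          (forall v, v \in Es w ->
             vnorm (cocycle_nat n w *m v)
               <= K * expR (- c * n%:R) * vnorm v) /\
          (forall v, v \in Eu (iter n T w) ->
             vnorm (invmx (cocycle_nat n w) *m v)
               <= K * expR (- c * n%:R) * vnorm v)]].

End dynamics.

Definition opnorm_on (R : realType) (d : nat) (A : 'M[Cx R]_d)
    (F : {vspace 'cV[Cx R]_d}) : \bar R :=
  ereal_sup [set (vnorm (A *m v))%:E | v in [set v | v \in F /\ vnorm v <= 1]].

Section l2.
Context (R : realType) (m : nat).
Local Notation seqZ := (int -> 'cV[Cx R]_m).

Definition l2sq (u : seqZ) : \bar R :=
  (\esum_(n in [set: int]) ((vnorm (u n)) ^+ 2)%:E)%E.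

Definition l2 : set seqZ := [set u | (l2sq u < +oo)%E].

Definition l2norm (u : seqZ) : R := Num.sqrt (fine (l2sq u)).

Definition sumZ (a : int -> R) : R :=
  limn (fun N : nat => \sum_(k < N.*2.+1) a (k%:Z - N%:Z)).

(* Antilinear in the first argument.  On l2 the series converges absolutely,
   so summing over symmetric intervals is no restriction. *)
Definition l2dot (u v : seqZ) : Cx R :=
  sumZ (fun n => complex.Re (dotc (u n) (v n)))
  +i* sumZ (fun n => complex.Im (dotc (u n) (v n))).

Definition orthogonal_projection (Q : seqZ -> seqZ) : Prop :=
  [/\ forall u, l2 u -> l2 (Q u),
      forall (a : Cx R) u v, l2 u -> l2 v -> Q (a *: u + v) = a *: Q u + Q v,
      forall u, l2 u -> Q (Q u) = Q u &
      forall u v, l2 u -> l2 v -> l2dot (Q u) v = l2dot u (Q v)].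

Local Notation borel := (set (measurableTypeR R)).

(* Bounded projection-valued measures, as in Reed and Simon, section VII.3. *)
Definition projection_valued_measure (P : borel -> seqZ -> seqZ) : Prop :=
  [/\ forall B, measurable B -> orthogonal_projection (P B),
      (forall u, l2 u -> P set0 u = 0) /\
        (exists a : R, forall u, l2 u -> P [set` `](- a), a[] u = u),
      forall F : nat -> borel, (forall n, measurable (F n)) ->
        trivIset setT F -> forall u, l2 u ->
        l2norm (P (\bigcup_n F n) u - \sum_(k < n) P (F k) u) @[n --> \oo]
          --> (0 : R) &
      forall A B, measurable A -> measurable B ->
        forall u, l2 u -> P (A `&` B) u = P A (P B u)].

Definition scalar_measure (P : borel -> seqZ -> seqZ) (u : seqZ)
    (mu : {measure set (measurableTypeR R) -> \bar R}) : Prop :=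
  forall B, measurable B -> mu B = (complex.Re (l2dot u (P B u)))%:E.

(* P is the spectral resolution of H, i.e. H is the integral of x dP(x) in the
   sense of quadratic forms. *)
Definition spectral_resolution (H : seqZ -> seqZ)
    (P : borel -> seqZ -> seqZ) : Prop :=
  projection_valued_measure P /\
  forall u, l2 u -> exists2 mu : {measure set (measurableTypeR R) -> \bar R},
    scalar_measure P u mu & l2dot u (H u) = (\int[mu]_x x)%R%:C.

Definition spectral_measure (H : seqZ -> seqZ) (u : seqZ)
    (mu : {measure set (measurableTypeR R) -> \bar R}) : Prop :=
  exists2 P, spectral_resolution H P & scalar_measure P u mu.

End l2.

Definition mutually_singular (R : realType)
    (mu nu : {measure set (measurableTypeR R) -> \bar R}) : Prop :=
  exists N, [/\ measurable N, mu N = 0%E & nu (~` N) = 0%E].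

(* nu is the singular part in the Lebesgue decomposition of mu. *)
Definition singular_part (R : realType)
    (mu nu : {measure set (measurableTypeR R) -> \bar R}) : Prop :=
  exists ac : {measure set (measurableTypeR R) -> \bar R},
    [/\ ac `<< (@lebesgue_measure R),
        mutually_singular (@lebesgue_measure R) nu &
        forall B, measurable B -> mu B = (ac B + nu B)%E].

(* B need not be measurable: mass zero means being contained in a Borel set of
   mass zero. *)
Definition purely_ac_on (R : realType) (m : nat)
    (H : (int -> 'cV[Cx R]_m) -> int -> 'cV[Cx R]_m) (B : set R) : Prop :=
  forall u mu nu, l2 u -> spectral_measure H u mu -> singular_part mu nu ->
    nu.-negligible (B : set (measurableTypeR R)).

Section strip.
Context (R : realType) (Omega : metricType R) (T Tinv : Omega -> Omega).
Context (m : nat) (C : 'M[Cx R]_m) (V : Omega -> 'M[Cx R]_m).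

Definition schrodinger_operator (w : Omega) (u : int -> 'cV[Cx R]_m) :
    int -> 'cV[Cx R]_m :=
  fun n => C *m u (n + 1) + V (iterz T Tinv n w) *m u n + C^t* *m u (n - 1).

Definition schrodinger_cocycle (E : R) (w : Omega) : 'M[Cx R]_(m + m) :=
  block_mx (invmx C *m ((E%:C)%:M - V w)) (- (invmx C *m C^t*))
           1%:M 0.

Definition bounded_center_set (J : set R)
    (Ec : R -> Omega -> {vspace 'cV[Cx R]_(m + m)}) (w : Omega) : set R :=
  [set E | J E /\
    (ereal_sup [set opnorm_on (cocycle T Tinv (schrodinger_cocycle E) n w)
                      (Ec E w) | n in [set: int]] < +oo)%E].

End strip.

(* Main.v *)
Require Import Defs.
From HB Require Import structures.
From mathcomp Require Import all_boot all_order all_algebra.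
From mathcomp Require Import complex.
From mathcomp Require Import all_classical all_reals all_analysis.
From mathcomp Require Import measurable_realfun ring lra zify.

(** Let E lie in B_w.  Splitting the initial data along Eu + Ec + Es writes every
    solution of H v = E v as a sum of three solutions, each bounded on a half
    line.  For I = ]E - e, E + e[ and a basis vector d = delta_{n,i}, the vector
    f = P(I) d satisfies |(H - E) f| <= e |f| and |f|^2 = <d, f> = mu_d(I).
    Summing Green's identity between f and a solution v bounded on a half line,
    and averaging over the first 1/e sites, bounds the square of the Wronskian of
    v and f at n by K e |f|^2.  The three solutions can be chosen so that their
    Wronskians with f at n add up to - |f|^2, whence mu_d(I) <= K' e for all e in
    ]0, 1].  A measure with such a density bound on a set gives no mass to the
    Lebesgue-null part of that set; as P(B) vanishes once it kills every basis
    vector, this covers all spectral measures. *)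

Import Order.TTheory GRing.Theory Num.Theory.
Import numFieldNormedType.Exports.

Local Open Scope classical_set_scope.
Local Open Scope ring_scope.
Local Open Scope sesquilinear_scope.

Set Implicit Arguments.
Unset Strict Implicit.
Unset Printing Implicit Defensive.

(** Discriminant argument: take [t = c / a]. If [a = 0], a linear function of [t] is bounded above,
    so [c = 0]. *)
Lemma sqr_le_mul_of_quadratic (F : realFieldType) (a b c : F) :
  0 <= a -> (forall t, 2 * t * c <= t ^+ 2 * a + b) -> c ^+ 2 <= a * b.
Proof.
rewrite le_eqVlt => /orP[/eqP <-|a0] H.
  have [->|c0] := eqVneq c 0; first by rewrite expr0n /= mul0r.
  have := H ((b + 1) / (2 * c)).
  by rewrite mulr0 add0r (_ : 2 * _ * c = b + 1); [lra|field].
have := H (c / a).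
rewrite (_ : (c / a) ^+ 2 * a = c ^+ 2 / a); last by field; rewrite gt_eqF.
rewrite (_ : 2 * (c / a) * c = 2 * (c ^+ 2 / a)); last by field; rewrite gt_eqF.
move=> h; have : c ^+ 2 / a <= b by lra.
by rewrite ler_pdivrMr // mulrC.
Qed.

Lemma sum_ord_le (F : numDomainType) k (f : 'I_k -> F) c :
  (forall i, f i <= c) -> \sum_i f i <= k%:R * c.
Proof.
move=> fc; rewrite (le_trans (ler_sum _ (fun i _ => fc i))) //.
by rewrite sumr_const card_ord mulr_natl.
Qed.

(** * [C^k] as a real Euclidean space *)

Section rdot.
Context {R : realType}.

(** Keeping only the real part makes every estimate one between real numbers, while adjoints can
    still be moved across the product. *)
Definition rdot k (x y : 'cV[Cx R]_k) : R := complex.Re (dotc x y).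

Lemma Re_conjM (a b : Cx R) :
  complex.Re (a^* * b) = complex.Re a * complex.Re b + complex.Im a * complex.Im b.
Proof. by case: a b => [a1 a2] [b1 b2] /=; ring. Qed.

(** Multiplicativity of the squared modulus, with the squared modulus of [a] written as the real
    part of [a^* * a]. *)
Lemma sqr_modM (a b : Cx R) :
  complex.Re (a^* * b) * complex.Re (a^* * b)
  + complex.Im (a^* * b) * complex.Im (a^* * b) =
  complex.Re (a^* * a) * (complex.Re b * complex.Re b + complex.Im b * complex.Im b).
Proof. by case: a b => [a1 a2] [b1 b2] /=; ring. Qed.

Lemma sqr_Re_norm (a : Cx R) :
  (complex.Re `|a|) ^+ 2 = complex.Re a ^+ 2 + complex.Im a ^+ 2.
Proof. by case: a => [a1 a2] /=; rewrite sqr_sqrtr // addr_ge0 ?sqr_ge0. Qed.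

Lemma rdotE k (x y : 'cV[Cx R]_k) : rdot x y =
  \sum_(i < k) (complex.Re (x i 0) * complex.Re (y i 0)
                + complex.Im (x i 0) * complex.Im (y i 0)).
Proof.
rewrite /rdot /dotc raddf_sum /=; apply: eq_bigr => i _; exact: Re_conjM.
Qed.

Lemma rdotC k (x y : 'cV[Cx R]_k) : rdot x y = rdot y x.
Proof. by rewrite !rdotE; apply: eq_bigr => i _; ring. Qed.

Lemma rdotDr k (x y z : 'cV[Cx R]_k) : rdot x (y + z) = rdot x y + rdot x z.
Proof.
rewrite !rdotE -big_split; apply: eq_bigr => i _ /=.
by rewrite !mxE !raddfD /=; ring.
Qed.

Lemma rdotDl k (x y z : 'cV[Cx R]_k) : rdot (y + z) x = rdot y x + rdot z x.
Proof. by rewrite rdotC rdotDr !(rdotC x). Qed.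

Lemma rdotZr k (t : R) (x y : 'cV[Cx R]_k) :
  rdot x ((t%:C)%C *: y) = t * rdot x y.
Proof.
rewrite !rdotE mulr_sumr; apply: eq_bigr => i _ /=.
by rewrite !mxE /=; case: (y i 0) => a b /=; ring.
Qed.

Lemma rdotZl k (t : R) (x y : 'cV[Cx R]_k) :
  rdot ((t%:C)%C *: x) y = t * rdot x y.
Proof. by rewrite rdotC rdotZr rdotC. Qed.

Lemma rdot0r k (x : 'cV[Cx R]_k) : rdot x 0 = 0.
Proof. by rewrite -[X in rdot x X](scale0r (0 : 'cV[Cx R]_k)) (rdotZr 0) mul0r. Qed.

Lemma rdot0l k (x : 'cV[Cx R]_k) : rdot 0 x = 0.
Proof. by rewrite rdotC rdot0r. Qed.

Lemma rdotNr k (x y : 'cV[Cx R]_k) : rdot x (- y) = - rdot x y.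
Proof. by apply/eqP; rewrite -addr_eq0 -rdotDr addNr rdot0r. Qed.

Lemma rdotNl k (x y : 'cV[Cx R]_k) : rdot (- x) y = - rdot x y.
Proof. by rewrite rdotC rdotNr rdotC. Qed.

Lemma sqr_vnorm k (v : 'cV[Cx R]_k) : vnorm v ^+ 2 = rdot v v.
Proof.
rewrite /vnorm sqr_sqrtr; last by apply: sumr_ge0 => i _; exact: sqr_ge0.
by rewrite rdotE; apply: eq_bigr => i _; rewrite sqr_Re_norm !expr2.
Qed.

Lemma rdot_ge0 k (x : 'cV[Cx R]_k) : 0 <= rdot x x.
Proof. by rewrite -sqr_vnorm sqr_ge0. Qed.

Lemma rdot_cauchy k (x y : 'cV[Cx R]_k) :
  rdot x y ^+ 2 <= rdot x x * rdot y y.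
Proof.
apply: sqr_le_mul_of_quadratic => [|t]; first exact: rdot_ge0.
have := rdot_ge0 ((t%:C)%C *: x - y).
by rewrite !(rdotDl, rdotDr, rdotNl, rdotNr, rdotZl, rdotZr) (rdotC y x); lra.
Qed.

Lemma rdot_young k (x y : 'cV[Cx R]_k) :
  `|rdot x y| <= rdot x x + rdot y y.
Proof.
have := rdot_ge0 (x + y); have := rdot_ge0 (x - y).
have := rdot_ge0 x; have := rdot_ge0 y.
rewrite !(rdotDl, rdotDr, rdotNl, rdotNr) (rdotC y x) ler_norml => *.
by apply/andP; split; lra.
Qed.

Lemma rdot_add_le k (x y : 'cV[Cx R]_k) :
  rdot (x + y) (x + y) <= 2 * (rdot x x + rdot y y).
Proof.
have := rdot_ge0 (x - y).
rewrite !(rdotDl, rdotDr, rdotNl, rdotNr) (rdotC y x); lra.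
Qed.

Lemma dotc_adj j k (A : 'M[Cx R]_(j, k)) (x : 'cV[Cx R]_j) (y : 'cV[Cx R]_k) :
  dotc x (A *m y) = dotc (A^t* *m x) y.
Proof.
rewrite /dotc.
under eq_bigr => i _ do rewrite mxE mulr_sumr.
rewrite exchange_big; apply: eq_bigr => l _ /=.
rewrite mxE rmorph_sum mulr_suml; apply: eq_bigr => i _ /=.
by rewrite !mxE rmorphM /= conjCK mulrA (mulrC (x i 0)^* ).
Qed.

Lemma rdot_adj j k (A : 'M[Cx R]_(j, k)) (x : 'cV[Cx R]_j) (y : 'cV[Cx R]_k) :
  rdot x (A *m y) = rdot (A^t* *m x) y.
Proof. by rewrite /rdot dotc_adj. Qed.

Lemma rdot_eq0 k (x : 'cV[Cx R]_k) : rdot x x <= 0 -> x = 0.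
Proof.
rewrite rdotE => h; apply/matrixP => i j; rewrite ord1 mxE.
have H (l : 'I_k) : true -> 0 <= complex.Re (x l 0) * complex.Re (x l 0)
                + complex.Im (x l 0) * complex.Im (x l 0).
  by move=> _; rewrite -!expr2 addr_ge0 ?sqr_ge0.
have := @psumr_eq0P _ _ _ _ H; move/(_ _ i isT) => hi.
have {}hi : complex.Re (x i 0) * complex.Re (x i 0)
                + complex.Im (x i 0) * complex.Im (x i 0) = 0.
  by apply: hi; apply/eqP; rewrite eq_le h sumr_ge0.
have := sqr_ge0 (complex.Re (x i 0)); have := sqr_ge0 (complex.Im (x i 0)).
move: hi; rewrite -!expr2; case: (x i 0) => a b /= hi ha hb.
have /eqP : a ^+ 2 = 0 by lra.
have /eqP : b ^+ 2 = 0 by lra.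
by rewrite !sqrf_eq0 => /eqP -> /eqP ->.
Qed.

Definition entry_bound j k (b : R) (A : 'M[Cx R]_(j, k)) :=
  forall i l, complex.Re (A i l) ^+ 2 + complex.Im (A i l) ^+ 2 <= b.

Lemma entry_bound_ex j k (A : 'M[Cx R]_(j, k)) :
  exists2 b, 0 <= b & entry_bound b A.
Proof.
pose F i l := complex.Re (A i l) ^+ 2 + complex.Im (A i l) ^+ 2.
have F0 i l : 0 <= F i l by rewrite addr_ge0 ?sqr_ge0.
exists (\sum_i \sum_l F i l) => [|i l]; first by do 2 apply: sumr_ge0 => ? _.
rewrite (bigD1 i) //= (bigD1 l) //= -/(F i l) -addrA lerDl.
by rewrite addr_ge0 ?sumr_ge0 // => ? _; rewrite sumr_ge0.
Qed.

Lemma rdot_mulmx_le j k b (A : 'M[Cx R]_(j, k)) x : entry_bound b A ->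
  rdot (A *m x) (A *m x) <= j%:R * (k%:R * b) * rdot x x.
Proof.
(* Each entry of [A *m x] is the pairing of [x] with a row of [A]. *)
move=> Ab; rewrite {1}rdotE -mulrA.
apply: sum_ord_le => i; rewrite -!expr2.
pose r := (row i A)^t*.
have rr : rdot r r <= k%:R * b.
  rewrite rdotE; apply: sum_ord_le => l; rewrite !mxE -!expr2.
  by have := Ab i l; case: (A i l) => a c /=; rewrite sqrrN.
have e : (A *m x) i 0 = dotc r x.
  by rewrite mxE; apply: eq_bigr => l _; rewrite !mxE conjCK.
pose d := dotc r x; rewrite e -/d.
(* rotate [x] by the phase of [d] to bound the complex modulus *)
have D0 : complex.Re d ^+ 2 + complex.Im d ^+ 2 = complex.Re (d^* * d).
  by rewrite Re_conjM !expr2.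
have D1 : rdot r (d^* *: x) = complex.Re (d^* * d).
  rewrite /rdot /d {3}/dotc /dotc mulr_sumr; congr complex.Re.
  by apply: eq_bigr => l _; rewrite !mxE mulrCA.
have D2 : rdot (d^* *: x) (d^* *: x) = complex.Re (d^* * d) * rdot x x.
  rewrite !rdotE mulr_sumr; apply: eq_bigr => l _.
  by rewrite !mxE sqr_modM.
have := rdot_cauchy r (d^* *: x); rewrite D1 D2 D0.
have : 0 <= complex.Re (d^* * d) by rewrite -D0 addr_ge0 ?sqr_ge0.
have := rdot_ge0 x; have := rdot_ge0 r.
move: (complex.Re _) (rdot x x) (rdot r r) rr => D X S rr S0 X0.
rewrite le_eqVlt => /orP[/eqP <- _|D0' h].
  by rewrite mulr_ge0 // (le_trans S0).
have : D <= S * X by rewrite -(ler_pM2l D0'); lra.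
by move=> /le_trans; apply; rewrite ler_wpM2r.
Qed.

End rdot.

(** * Symmetric partial sums of families indexed by the integers *)

Section symmetric_sums.
Context {R : realType}.
Implicit Types (a b : int -> R) (N : nat).

Definition psum a N : R := \sum_(k < N.*2.+1) a (k%:Z - N%:Z).

Lemma psumD a b N : psum (fun n => a n + b n) N = psum a N + psum b N.
Proof. exact: big_split. Qed.

Lemma psumZ t a N : psum (fun n => t * a n) N = t * psum a N.
Proof. by rewrite /psum -mulr_sumr. Qed.

Lemma psum_ge0 a N : (forall n, 0 <= a n) -> 0 <= psum a N.
Proof. by move=> a0; apply: sumr_ge0 => i _. Qed.

Lemma ler_psum a b N : (forall n, a n <= b n) -> psum a N <= psum b N.
Proof. by move=> ab; apply: ler_sum => i _. Qed.

Lemma psumS a N :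
  psum a N.+1 = a (- N.+1%:Z) + psum a N + a N.+1%:Z.
Proof.
rewrite {1}/psum doubleS big_ord_recl big_ord_recr /= addrA; congr (_ + _ + _).
- by congr a; lia.
- by apply: eq_bigr => i _; congr a; rewrite /bump /=; lia.
- by congr a; rewrite /bump /=; lia.
Qed.

Lemma psum_ge_term a N k : (forall n, 0 <= a n) -> (`|k| <= N)%N -> a k <= psum a N.
Proof.
move=> a0 kN; have kp : (`|(k + N%:Z)%R|%N < N.*2.+1)%N by lia.
rewrite /psum (bigD1 (Ordinal kp)) //= (_ : _ - _ = k); last by lia.
by rewrite lerDl sumr_ge0.
Qed.

Lemma psum_nondecreasing a : (forall n, 0 <= a n) -> nondecreasing_seq (psum a).
Proof.
move=> a0; apply/nondecreasing_seqP => N.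
by rewrite psumS; have := a0 (- N.+1%:Z); have := a0 N.+1%:Z; lra.
Qed.

Lemma psum_shift_next a N : (forall n, 0 <= a n) ->
  psum (fun n => a (n + 1)) N <= psum a N.+1.
Proof.
move=> a0; rewrite {2}/psum doubleS 2!big_ord_recl addrA.
rewrite -[X in X <= _]add0r; apply: lerD; first exact: addr_ge0.
apply: ler_sum => i _.
rewrite (_ : (i%:Z - N%:Z + 1 = (lift ord0 (lift ord0 i))%:Z - N.+1%:Z)) //.
by rewrite /= /bump /=; lia.
Qed.

Lemma psum_shift_prev a N : (forall n, 0 <= a n) ->
  psum (fun n => a (n - 1)) N <= psum a N.+1.
Proof.
move=> a0; rewrite {2}/psum doubleS 2!big_ord_recr /= -addrA.
rewrite -[X in X <= _]addr0; apply: lerD; last exact: addr_ge0.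
by apply: ler_sum => i _; rewrite (_ : _ - 1 = i%:Z - N.+1%:Z) //; lia.
Qed.

(** [a] is the difference of the nonnegative families [a + b] and [b], whose partial sums are
    monotone and bounded. *)
Lemma psum_cvgn_le a b M : (forall n, `|a n| <= b n) ->
  (forall N, psum b N <= M) -> cvgn (psum a).
Proof.
move=> ab bM.
have b0 n : 0 <= b n by exact: le_trans (normr_ge0 _) (ab n).
have mono c K : (forall n, 0 <= c n) -> (forall N, psum c N <= K) -> cvgn (psum c).
  move=> c0 cK; apply: nondecreasing_is_cvgn; first exact: psum_nondecreasing.
  by exists K => _ [N _ <-].
rewrite (_ : psum a = psum (fun n => a n + b n) - psum b); last first.
  by apply/funext => N; rewrite !fctE psumD addrK.
apply: is_cvgB; last exact: mono b0 bM.
apply: (mono _ (M + M)) => [n|N].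
  by have := ab n; rewrite ler_norml => /andP[]; lra.
rewrite psumD lerD // (le_trans _ (bM N)) //; apply: ler_psum => n.
exact: le_trans (ler_norm _) (ab n).
Qed.

Lemma cvg_psum_sumZ a s : psum a @ \oo --> s -> sumZ a = s.
Proof. by move=> h; apply/cvg_lim. Qed.

Lemma psum_cvgn_sumZ a : cvgn (psum a) -> psum a @ \oo --> sumZ a.
Proof. by []. Qed.

Lemma psum_single a k : (forall n, n != k -> a n = 0) ->
  psum a @ \oo --> a k.
Proof.
move=> ak; apply: cvg_near_cst; exists `|k|%N => // N /= kN.
have kp : (`|(k + N%:Z)%R|%N < N.*2.+1)%N by lia.
rewrite /psum (bigD1 (Ordinal kp)) //= big1 ?addr0 => [|i ik].
  by congr a; lia.
by apply: ak; apply: contra ik => /eqP e; apply/eqP/val_inj => /=; lia.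
Qed.

Lemma sumZ_single a k : (forall n, n != k -> a n = 0) -> sumZ a = a k.
Proof. by move=> ak; apply: cvg_psum_sumZ; exact: psum_single. Qed.

(** The two end terms are the increment from [psum a N] to [psum a N.+1]. *)
Lemma psum_ends_cvg0 a : cvgn (psum a) ->
  (fun N => a (- N.+1%:Z) + a N.+1%:Z) @ \oo --> (0 : R).
Proof.
move=> ca; have h := psum_cvgn_sumZ ca.
rewrite -(subrr (sumZ a)) (_ : (fun _ => _) = (fun N => psum a N.+1) - psum a).
  by apply: cvgB => //; rewrite (cvg_shiftS (psum a)).
by apply/funext => N; rewrite !fctE psumS; lra.
Qed.

Lemma esum_psum_le a N : (forall n, 0 <= a n) ->
  ((psum a N)%:E <= \esum_(n in [set: int]) (a n)%:E)%E.
Proof.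
move=> a0; apply: esum_ge.
pose r : seq int := [seq (k%:Z - N%:Z) | k <- iota 0 N.*2.+1].
exists [set` r]; first by split => //; exact: finite_seq.
rewrite -fsbig_seq /r; last first.
  by rewrite map_inj_uniq ?iota_uniq // => i j; lia.
rewrite big_map sumEFin lee_fin /psum.
by rewrite -(big_mkord xpredT (fun k => a (k%:Z - N%:Z))) /index_iota subn0.
Qed.

(** Every finite set of indices lies in a symmetric interval. Together with [esum_psum_le], this
    turns membership in [l2] into boundedness of [psum]. *)
Lemma esum_le_psum a M : (forall n, 0 <= a n) -> (forall N, psum a N <= M) ->
  (\esum_(n in [set: int]) (a n)%:E <= M%:E)%E.
Proof.
move=> a0 aM; apply: ge_ereal_sup => _ [A [finA _] <-].
have /finite_seqP[s As] := finA.
pose N := \max_(n <- s) `|n|%N.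
pose r : seq int := [seq (k%:Z - N%:Z) | k <- iota 0 N.*2.+1].
apply: (@le_trans _ _ (\sum_(n \in [set` r]) (a n)%:E)%E).
  apply: lee_fsum_nneg_subset => //; first exact: finite_seq.
    rewrite As => n; rewrite !inE /= => ns.
    have nN : (`|n| <= N)%N by apply: leq_bigmax_seq.
    by apply/mapP; exists `|(n + N%:Z)%R|%N; rewrite ?mem_iota; lia.
  by move=> n _; rewrite lee_fin.
rewrite -fsbig_seq /r; last first.
  by rewrite map_inj_uniq ?iota_uniq // => i j; lia.
rewrite big_map sumEFin lee_fin (le_trans _ (aM N)) // /psum.
by rewrite -(big_mkord xpredT (fun k => a (k%:Z - N%:Z))) /index_iota subn0.
Qed.

End symmetric_sums.

(** * The real inner product on [l2], and truncations to finitely many sites *)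

Section l2_real_structure.
Context {R : realType} {m : nat}.
Local Notation seqZ := (int -> 'cV[Cx R]_m).
Implicit Types (u v w : seqZ) (t : R).

Definition ip u v : R := complex.Re (l2dot u v).

Lemma ipE u v : ip u v = sumZ (fun n => rdot (u n) (v n)).
Proof. by []. Qed.

Lemma l2P u :
  l2 u <-> exists M, forall N, psum (fun n => rdot (u n) (u n)) N <= M.
Proof.
have e : l2sq u = (\esum_(n in [set: int]) (rdot (u n) (u n))%:E)%E.
  by apply: eq_esum => n _; rewrite sqr_vnorm.
rewrite /l2 /= e; split => [|[M uM]]; last first.
  apply: le_lt_trans (ltry M); apply: esum_le_psum => // n; exact: rdot_ge0.
set s := (\esum_(_ in _) _)%E => s_fin.
have s_num : s \is a fin_num.
  by rewrite ge0_fin_numE // esum_ge0 // => n _; rewrite lee_fin rdot_ge0.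
exists (fine s) => N; rewrite -lee_fin fineK //.
by apply: esum_psum_le => n; exact: rdot_ge0.
Qed.

Lemma ip_cvg u v : l2 u -> l2 v ->
  psum (fun n => rdot (u n) (v n)) @ \oo --> ip u v.
Proof.
move=> /l2P[M uM] /l2P[K vK]; apply: psum_cvgn_sumZ.
apply: (@psum_cvgn_le _ _ (fun n => rdot (u n) (u n) + rdot (v n) (v n)) (M + K)).
  by move=> n; exact: rdot_young.
by move=> N; rewrite psumD lerD.
Qed.

Lemma l2D u v : l2 u -> l2 v -> l2 (u + v).
Proof.
move=> /l2P[M uM] /l2P[K vK]; apply/l2P; exists (2 * (M + K)) => N.
apply: (@le_trans _ _ (psum (fun n => 2 * (rdot (u n) (u n) + rdot (v n) (v n))) N)).
  by apply: ler_psum => n; exact: rdot_add_le.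
by rewrite psumZ psumD ler_wpM2l // lerD.
Qed.

Lemma l2Z t u : l2 u -> l2 ((t%:C)%C *: u).
Proof.
move=> /l2P[M uM]; apply/l2P; exists (t ^+ 2 * M) => N.
rewrite (_ : (fun n => _) = (fun n => t ^+ 2 * rdot (u n) (u n))).
  by rewrite psumZ ler_wpM2l // sqr_ge0.
by apply/funext => n; rewrite rdotZl rdotZr expr2 mulrA.
Qed.

Lemma scaler_realN1 u : ((-1)%:C)%C *: u = - u.
Proof. by rewrite rmorphN1 scaleN1r. Qed.

Lemma l2N u : l2 u -> l2 (- u).
Proof. by move=> lu; rewrite -scaler_realN1; exact: l2Z. Qed.

Lemma l2B u v : l2 u -> l2 v -> l2 (u - v).
Proof. by move=> lu lv; apply: l2D => //; exact: l2N. Qed.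

Lemma l2_0 : l2 (0 : seqZ).
Proof.
by apply/l2P; exists 0 => N; rewrite /psum big1 // => i _; exact: rdot0r.
Qed.

Lemma l2_sum (I : Type) (r : seq I) (F : I -> seqZ) :
  (forall i, l2 (F i)) -> l2 (\sum_(i <- r) F i).
Proof. by move=> lF; elim/big_rec: _ => [|i u _]; [exact: l2_0|exact: l2D]. Qed.

Lemma l2_shift_next u : l2 u -> l2 (fun n => u (n + 1)).
Proof.
move=> /l2P[M uM]; apply/l2P; exists M => N.
apply: le_trans (uM N.+1); apply: (@psum_shift_next _ (fun n => rdot (u n) (u n))).
by move=> n; exact: rdot_ge0.
Qed.

Lemma l2_shift_prev u : l2 u -> l2 (fun n => u (n - 1)).
Proof.
move=> /l2P[M uM]; apply/l2P; exists M => N.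
apply: le_trans (uM N.+1); apply: (@psum_shift_prev _ (fun n => rdot (u n) (u n))).
by move=> n; exact: rdot_ge0.
Qed.

Lemma l2_mulmx (A : int -> 'M[Cx R]_m) b u :
  (forall n, entry_bound b (A n)) -> l2 u -> l2 (fun n => A n *m u n).
Proof.
move=> Ab /l2P[M uM]; apply/l2P; have [b0|b0] := leP 0 b; last first.
  (* A negative [b] forces [m = 0], since any entry would have a negative squared modulus. *)
  exists 0 => N; rewrite /psum big1 // => i _.
  suff -> : A (i%:Z - N%:Z) *m u (i%:Z - N%:Z) = 0 by exact: rdot0r.
  apply/matrixP => j l; have := Ab 0 j j => /le_lt_trans/(_ b0).
  by rewrite ltNge addr_ge0 ?sqr_ge0.
exists (m%:R * (m%:R * b) * M) => N.
apply: (@le_trans _ _ (psum (fun n => m%:R * (m%:R * b) * rdot (u n) (u n)) N)).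
  by apply: ler_psum => n; exact: rdot_mulmx_le.
by rewrite psumZ ler_wpM2l // !mulr_ge0.
Qed.

Lemma ipC u v : ip u v = ip v u.
Proof. by rewrite !ipE; congr sumZ; apply/funext => n; exact: rdotC. Qed.

Lemma ipDr u v w : l2 u -> l2 v -> l2 w -> ip u (v + w) = ip u v + ip u w.
Proof.
move=> lu lv lw; apply: cvg_psum_sumZ.
rewrite (_ : (fun n => _) = (fun n => rdot (u n) (v n) + rdot (u n) (w n))).
  rewrite (_ : psum _ = psum (fun n => rdot (u n) (v n)) + psum (fun n => rdot (u n) (w n))).
    by apply: cvgD; exact: ip_cvg.
  by apply/funext => N; rewrite psumD.
by apply/funext => n; exact: rdotDr.
Qed.

Lemma ipDl u v w : l2 u -> l2 v -> l2 w -> ip (v + w) u = ip v u + ip w u.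
Proof. by move=> lu lv lw; rewrite ipC ipDr // !(ipC u). Qed.

Lemma ipZr t u v : l2 u -> l2 v -> ip u ((t%:C)%C *: v) = t * ip u v.
Proof.
move=> lu lv; apply: cvg_psum_sumZ.
rewrite (_ : psum _ = t *: psum (fun n => rdot (u n) (v n))).
  by apply: cvgZl_tmp; exact: ip_cvg.
apply/funext => N; rewrite fctE /= -[RHS]psumZ; congr (psum _ _).
by apply/funext => n; exact: rdotZr.
Qed.

Lemma ipZl t u v : l2 u -> l2 v -> ip ((t%:C)%C *: v) u = t * ip v u.
Proof. by move=> lu lv; rewrite ipC ipZr // (ipC u). Qed.

Lemma ipNr u v : l2 u -> l2 v -> ip u (- v) = - ip u v.
Proof. by move=> lu lv; rewrite -scaler_realN1 ipZr // mulN1r. Qed.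

Lemma ipBr u v w : l2 u -> l2 v -> l2 w -> ip u (v - w) = ip u v - ip u w.
Proof. by move=> lu lv lw; rewrite ipDr ?ipNr //; exact: l2N. Qed.

Lemma ipBl u v w : l2 u -> l2 v -> l2 w -> ip (v - w) u = ip v u - ip w u.
Proof. by move=> lu lv lw; rewrite ipC ipBr // !(ipC u). Qed.

Lemma ip0r u : ip u 0 = 0.
Proof.
apply: cvg_psum_sumZ; rewrite (_ : psum _ = cst 0); first exact: cvg_cst.
by apply/funext => N; rewrite /psum big1 // => i _; exact: rdot0r.
Qed.

Lemma ip_ge0 u : l2 u -> 0 <= ip u u.
Proof.
move=> lu; have u0 n : 0 <= rdot (u n) (u n) := rdot_ge0 (u n).
apply: le_trans (psum_ge0 0 u0) _; apply: nondecreasing_cvgn_le.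
  exact: psum_nondecreasing.
exact: cvgP (ip_cvg lu lu).
Qed.

Definition delta (n : int) (x : 'cV[Cx R]_m) : seqZ :=
  fun k => if k == n then x else 0.

Lemma ip_delta n x v : ip (delta n x) v = rdot x (v n).
Proof.
rewrite ipE (@sumZ_single _ _ n) /delta ?eqxx // => k /negbTE ->.
exact: rdot0l.
Qed.

Lemma l2dot_delta n x v : l2dot (delta n x) v = dotc x (v n).
Proof.
rewrite /l2dot !(@sumZ_single _ _ n) /delta ?eqxx //; first by case: (dotc _ _).
all: by move=> k /negbTE ->; rewrite /dotc big1 // => i _; rewrite mxE rmorph0 mul0r.
Qed.

Lemma l2_delta n x : l2 (delta n x).
Proof.
apply/l2P; pose a k := rdot (delta n x k) (delta n x k).
have ca : psum a @ \oo --> a n.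
  by apply: psum_single => k /negbTE kn; rewrite /a /delta kn rdot0r.
have ia : nondecreasing_seq (psum a).
  by apply: psum_nondecreasing => k; exact: rdot_ge0.
exists (a n) => N; rewrite -(cvg_lim _ ca) //.
by apply: nondecreasing_cvgn_le => //; exact: cvgP ca.
Qed.

(** For injective [s], the truncation of [u] to the first [N] sites of the path [s]. The free choice
    of path lets both half lines be treated at once. *)
Definition restrict_seq (s : nat -> int) N u : seqZ :=
  \sum_(i < N) delta (s i) (u (s i)).

Lemma l2_restrict s N u : l2 (restrict_seq s N u).
Proof. by apply: l2_sum => i; exact: l2_delta. Qed.

Lemma ip_restrict s N u v : l2 v ->
  ip (restrict_seq s N u) v = \sum_(i < N) rdot (u (s i)) (v (s i)).
Proof.
move=> lv; rewrite /restrict_seq; elim: N => [|N IH].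
  by rewrite !big_ord0 ipC ip0r.
rewrite !big_ord_recr ipDl ?IH ?ip_delta //.
  by apply: l2_sum => i; exact: l2_delta.
exact: l2_delta.
Qed.

Lemma restrict_seqE (s : nat -> int) N u i : injective s -> (i < N)%N ->
  restrict_seq s N u (s i) = u (s i).
Proof.
move=> sI iN; rewrite /restrict_seq fct_sumE (bigD1 (Ordinal iN)) //=.
rewrite {1}/delta eqxx big1 ?addr0 // => j ji; rewrite /delta.
case: eqP => // /sI e; move: ji.
by rewrite (_ : j = Ordinal iN) ?eqxx //; exact: val_inj.
Qed.

Lemma ip_restrict_restrict (s : nat -> int) N u : injective s ->
  ip (restrict_seq s N u) (restrict_seq s N u) =
  \sum_(i < N) rdot (u (s i)) (u (s i)).
Proof.
move=> sI; rewrite ip_restrict; last exact: l2_restrict.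
by apply: eq_bigr => i _; rewrite restrict_seqE.
Qed.

(** Bessel's inequality: expand the nonnegative square norm of [u] minus its truncation. *)
Lemma sum_rdot_le_ip (s : nat -> int) N u : injective s -> l2 u ->
  \sum_(i < N) rdot (u (s i)) (u (s i)) <= ip u u.
Proof.
move=> sI lu; have lr := l2_restrict s N u.
have := ip_ge0 (l2B lu lr).
rewrite ipBr ?ipBl //; last exact: l2B.
rewrite ip_restrict_restrict // (ipC u (restrict_seq _ _ _)) ip_restrict //; lra.
Qed.

Lemma rdot_le_ip n u : l2 u -> rdot (u n) (u n) <= ip u u.
Proof.
move=> lu; have := @sum_rdot_le_ip (fun k => n + k%:Z) 1 u.
by rewrite big_ord1 /= addr0; apply => // i j; lia.
Qed.

Lemma ip_eq0 u : l2 u -> ip u u = 0 -> u = 0.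
Proof.
move=> lu u0; apply/funext => n; apply: rdot_eq0.
by rewrite -u0; exact: rdot_le_ip.
Qed.

End l2_real_structure.

(** * Green's identity and the symmetry of the strip operator *)

Lemma sqr_sub_le (F : realFieldType) (x y a b : F) :
  x ^+ 2 <= a -> y ^+ 2 <= b -> (x - y) ^+ 2 <= 2 * (a + b).
Proof. by have := sqr_ge0 (x + y); rewrite sqrrD sqrrB; lra. Qed.

Section strip_operator.
Context {R : realType} {m : nat} (C : 'M[Cx R]_m) (V : int -> 'M[Cx R]_m).
Context (V_herm : forall n, (V n)^t* = V n).
Local Notation seqZ := (int -> 'cV[Cx R]_m).
Implicit Types (u v w f : seqZ).

Definition strip_op u : seqZ :=
  fun n => C *m u (n + 1) + V n *m u n + C^t* *m u (n - 1).

(** The boundary term of summation by parts, carried by the bond between [n] and [n + 1]; like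
    [rdot], it keeps only the real part. *)
Definition wronskian u v (n : int) : R :=
  rdot (u n) (C *m v (n + 1)) - rdot (C *m u (n + 1)) (v n).

Lemma strip_opD u v : strip_op (u + v) = strip_op u + strip_op v.
Proof.
apply/funext => n; rewrite /strip_op !fctE !mulmxDr.
by rewrite [X in X + _ = _]addrACA [LHS]addrACA.
Qed.

Lemma strip_opZ (t : R) u :
  strip_op ((t%:C)%C *: u) = (t%:C)%C *: strip_op u.
Proof. by apply/funext => n; rewrite /strip_op !fctE -!scalemxAr !scalerDr. Qed.

Lemma l2_strip_op b u :
  (forall n, entry_bound b (V n)) -> l2 u -> l2 (strip_op u).
Proof.
move=> Vb lu; have [c _ Cc] := entry_bound_ex C.
have [c' _ Cc'] := entry_bound_ex (C^t*).
apply: l2D; last by apply: (l2_mulmx (b := c')) => //; exact: l2_shift_prev.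
apply: l2D; first by apply: (l2_mulmx (b := c)) => //; exact: l2_shift_next.
exact: l2_mulmx Vb lu.
Qed.

(** The potential terms cancel because [V n] is Hermitian. Moving the adjoint of [C] across the
    product turns the terms with site [n - 1] into the Wronskian on the preceding bond. *)
Lemma green_identity u v n :
  rdot (u n) (strip_op v n) - rdot (strip_op u n) (v n) =
  wronskian u v n - wronskian u v (n - 1).
Proof.
rewrite /wronskian /strip_op !rdotDr !rdotDl subrK.
rewrite (rdotC (u n) (C^t* *m _)) -!rdot_adj (rdot_adj (V n)) V_herm.
rewrite (rdotC (v (n - 1))).
have e (a d x f g : R) : a + d + x - (f + d + g) = a - f - (g - x) by ring.
exact: e.
Qed.

Lemma psum_wronskian u v N :
  psum (fun n => rdot (u n) (strip_op v n) - rdot (strip_op u n) (v n)) N =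
  wronskian u v N%:Z - wronskian u v (- N.+1%:Z).
Proof.
elim: N => [|N IH]; first by rewrite /psum big_ord1 green_identity.
rewrite psumS IH.
have h1 := green_identity u v (- N.+1%:Z); have h2 := green_identity u v N.+1%:Z.
apply: etrans (f_equal2 +%R (f_equal2 +%R h1 erefl) h2) _.
rewrite (_ : N.+1%:Z - 1 = N); last by lia.
rewrite (_ : - N.+1%:Z - 1 = - N.+2%:Z); last by lia.
have e (a d x y : R) : a - d + (x - a) + (y - x) = y - d by ring.
exact: e.
Qed.

(** Cauchy-Schwarz on each term. Since the factors of [u] and [v] stay separate, [v] can be summed
    over bonds while [u] is only bounded. *)
Lemma wronskian_sqr_le u v c n : entry_bound c C ->
  wronskian u v n ^+ 2 <=
  2 * (m%:R * (m%:R * c)) * (rdot (u n) (u n) * rdot (v (n + 1)) (v (n + 1))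
    + rdot (u (n + 1)) (u (n + 1)) * rdot (v n) (v n)).
Proof.
move=> Cc; rewrite -[2 * _ * _]mulrA mulrDr; apply: sqr_sub_le.
  rewrite mulrCA (le_trans (rdot_cauchy _ _)) //.
  by rewrite ler_wpM2l ?rdot_ge0 // rdot_mulmx_le.
rewrite mulrA (le_trans (rdot_cauchy _ _)) //.
by rewrite ler_wpM2r ?rdot_ge0 // rdot_mulmx_le.
Qed.

Lemma norm_wronskian_le u v n : `|wronskian u v n| <=
  (rdot (u n) (u n) + rdot (C *m v (n + 1)) (C *m v (n + 1))) +
  (rdot (C *m u (n + 1)) (C *m u (n + 1)) + rdot (v n) (v n)).
Proof. by apply: le_trans (ler_normB _ _) _; apply: lerD; exact: rdot_young. Qed.

(** Each Wronskian is dominated by finitely many terms of the summable families of square norms of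
    [u], [v], [C u] and [C v]. *)
Lemma cvg_wronskian_ends u v : l2 u -> l2 v ->
  (fun N : nat => wronskian u v N%:Z - wronskian u v (- N.+1%:Z)) @ \oo --> (0 : R).
Proof.
move=> lu lv; have [c _ Cc] := entry_bound_ex C.
have lC w : l2 w -> l2 (fun n => C *m w n) by move=> lw; apply: (l2_mulmx (b := c)).
pose r w n := rdot (w n) (w n).
have cr w : l2 w -> cvgn (psum (r w)) by move=> lw; exact: cvgP (ip_cvg lw lw).
pose e w N := r w (- N.+1%:Z) + r w N.+1%:Z.
have e0 w : l2 w -> e w @ \oo --> (0 : R) by move=> lw; exact: psum_ends_cvg0 (cr _ lw).
pose d w N := (e w N + e w N.+1) + (e (fun n => C *m w n) N + e (fun n => C *m w n) N.+1).
have d0 w : l2 w -> d w @ \oo --> (0 : R).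
  move=> lw; have cs x : l2 x -> (fun N => e x N + e x N.+1) @ \oo --> (0 : R).
    by move=> lx; rewrite -[0]addr0; apply: cvgD; rewrite ?(cvg_shiftS (e x)); exact: e0.
  by rewrite -[0]addr0; apply: cvgD; apply: cs; last exact: lC.
(* After the shift both bonds join sites of absolute value [N + 1] and [N + 2], exactly those in
   [e N] and [e N.+1]. *)
rewrite -cvg_shiftS /=.
apply: (@squeeze_cvgr _ _ _ _ (fun N => - (d u N + d v N)) (fun N => d u N + d v N)).
- near=> N; rewrite -ler_norml.
  apply: le_trans (ler_normB _ _) _.
  apply: le_trans (lerD (norm_wronskian_le _ _ _) (norm_wronskian_le _ _ _)) _.
  rewrite (_ : N.+1%:Z + 1 = N.+2%:Z); last by lia.
  rewrite (_ : - N.+2%:Z + 1 = - N.+1%:Z); last by lia.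
  have key (a1 a2 a3 a4 b1 b2 b3 b4 c1 c2 c3 c4 d1 d2 d3 d4 : R) :
      0 <= a2 -> 0 <= a3 -> 0 <= b2 -> 0 <= b3 -> 0 <= c1 -> 0 <= c4 ->
      0 <= d1 -> 0 <= d4 ->
      a1 + d2 + (c2 + b1) + (a4 + d3 + (c3 + b4)) <=
      a3 + a1 + (a4 + a2) + (c3 + c1 + (c4 + c2)) +
      (b3 + b1 + (b4 + b2) + (d3 + d1 + (d4 + d2))).
    by lra.
  by rewrite /d /e /r; apply: key; exact: rdot_ge0.
- rewrite -oppr0; apply: cvgN; rewrite -[0]addr0.
  by apply: cvgD; exact: d0.
- by rewrite -[0]addr0; apply: cvgD; exact: d0.
Unshelve. all: by end_near. Qed.

(** Summed over a symmetric interval, the difference of the two sides telescopes to Wronskians at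
    the ends, which tend to 0. *)
Lemma strip_op_sym b u v : (forall n, entry_bound b (V n)) -> l2 u -> l2 v ->
  ip u (strip_op v) = ip (strip_op u) v.
Proof.
move=> Vb lu lv.
have lHu := l2_strip_op Vb lu; have lHv := l2_strip_op Vb lv.
apply/eqP; rewrite -subr_eq0; apply/eqP.
have h : psum (fun n => rdot (u n) (strip_op v n) - rdot (strip_op u n) (v n)) @ \oo
   --> ip u (strip_op v) - ip (strip_op u) v.
  rewrite (_ : psum _ = psum (fun n => rdot (u n) (strip_op v n))
      - psum (fun n => rdot (strip_op u n) (v n))).
    by apply: cvgB; exact: ip_cvg.
  by apply/funext => N; rewrite !fctE /psum -sumrB.
have := cvg_wronskian_ends lu lv.
rewrite (_ : (fun _ => _) = psum (fun n => rdot (u n) (strip_op v n) - rdot (strip_op u n) (v n))).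
  by move=> h0; rewrite -(cvg_lim _ h) // (cvg_lim _ h0).
by apply/funext => N; rewrite psum_wronskian.
Qed.

End strip_operator.

(* Averaging over [L] indices costs [Y / L + e ^+ 2 * L * A]; take [1 / e <= L <= 2 / e]. *)
Lemma average_bound (R : realType) (x e A Y : R) (y : nat -> R) :
  0 < e <= 1 -> 0 <= A -> 0 <= Y ->
  (forall N, x ^+ 2 <= 2 * (y N + e ^+ 2 * (N.+1%:R * A))) ->
  (forall N, \sum_(i < N) y i <= Y) -> x ^+ 2 <= e * (2 * Y + 4 * A).
Proof.
move=> /andP[e0 e1] A0 Y0 xy yY.
pose L := (Num.truncn e^-1).+1.
have Le : e^-1 < L%:R by exact: truncnS_gt.
have eL : L%:R <= 2 * e^-1.
  have : 1 <= e^-1 by rewrite invr_ge1 ?unitfE ?gt_eqF.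
  have : (Num.truncn e^-1)%:R <= e^-1 by rewrite truncn_le // invr_ge0 ltW.
  by rewrite /L -[_.+1%:R]natr1; lra.
have L0 : 0 < L%:R :> R by rewrite ltr0n.
have H : L%:R * x ^+ 2 <= 2 * (Y + e ^+ 2 * (L%:R * (L%:R * A))).
  rewrite -[X in X * _](_ : \sum_(i < L) 1 = L%:R); last by rewrite sumr_const card_ord.
  rewrite mulr_suml.
  apply: (@le_trans _ _ (\sum_(i < L) 2 * (y i + e ^+ 2 * (L%:R * A)))).
    apply: ler_sum => i _; rewrite mul1r (le_trans (xy i)) // ler_wpM2l // lerD2l.
    by rewrite ler_wpM2l ?sqr_ge0 // ler_wpM2r // ler_nat.
  rewrite -mulr_sumr ler_wpM2l // big_split /= lerD ?yY //.
  by rewrite sumr_const card_ord -[_ *+ L]mulr_natl mulrCA.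
have Lei : L%:R * e >= 1 by rewrite -ler_pdivrMr // div1r ltW.
have eLi : L%:R * e <= 2 by rewrite -ler_pdivlMr.
rewrite -(ler_pM2l L0) (le_trans H) //.
set l := L%:R in L0 Lei eLi *.
have h1 : 0 <= (l * e - 1) * Y by rewrite mulr_ge0 // subr_ge0.
have h2 : 0 <= (2 - l * e) * (l * e * A).
  by rewrite mulr_ge0 ?subr_ge0 // mulr_ge0 // (le_trans _ Lei).
rewrite (_ : e ^+ 2 * (l * (l * A)) = (l * e) * (l * e * A)); last by ring.
rewrite (_ : l * (e * _) = 2 * (l * e * Y) + 4 * (l * e * A)); last by ring.
lra.
Qed.

(* [f] is nearly an eigenvector: [(H - E) f] has norm at most [e] times that of [f]. *)
Definition near_eigenvector {R : realType} {m : nat}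
    (H : (int -> 'cV[Cx R]_m) -> int -> 'cV[Cx R]_m) (E e : R) f :=
  forall h, l2 h -> ip h (H f - (E%:C)%C *: f) ^+ 2 <= e ^+ 2 * (ip h h * ip f f).

(** * Wronskians of half-line bounded solutions with near eigenvectors *)

Section half_line_solutions.
Context {R : realType} {m : nat} (C : 'M[Cx R]_m) (V : int -> 'M[Cx R]_m).
Context (V_herm : forall n, (V n)^t* = V n).
Context (b : R) (Vb : forall n, entry_bound b (V n)).
Local Notation seqZ := (int -> 'cV[Cx R]_m).
Local Notation H := (strip_op C V).

Definition eigensolution (E : R) (w : seqZ) := H w = (E%:C)%C *: w.

Definition bounded_on_half_line (w : seqZ) :=
  exists M, (forall n : nat, rdot (w n%:Z) (w n%:Z) <= M) \/
            (forall n : nat, rdot (w (- n%:Z)) (w (- n%:Z)) <= M).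

(** Moves the end of the half line from 0 to the bond at [n]. The sites in between have absolute
    value at most [|n| + 1], so a symmetric sum absorbs them. *)
Lemma half_line_bound (w : seqZ) n : bounded_on_half_line w ->
  exists2 M, 0 <= M &
    (forall N : nat, rdot (w (n + N%:Z)) (w (n + N%:Z)) <= M) \/
    (forall N : nat, rdot (w (n + 1 - N%:Z)) (w (n + 1 - N%:Z)) <= M).
Proof.
case=> M wM; pose r k := rdot (w k) (w k).
have r0 k : 0 <= r k := rdot_ge0 (w k).
have S0 : 0 <= psum r `|n|.+1 by exact: psum_ge0.
have M0 : 0 <= M.
  by case: wM => /(_ 0%N); apply: le_trans; exact: rdot_ge0.
exists (M + psum r `|n|.+1); first exact: addr_ge0.
case: wM => wM; [left|right] => N; rewrite -/(r _).
  have [nN|nN] := leP 0 (n + N%:Z).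
    have -> : n + N%:Z = `|(n + N%:Z)%R|%N by lia.
    by apply: le_trans (wM _) _; rewrite lerDl.
  apply: (@le_trans _ _ (psum r `|n|.+1)); last by rewrite lerDr.
  by apply: psum_ge_term => //; lia.
have [nN|nN] := leP (n + 1 - N%:Z) 0.
  have -> : n + 1 - N%:Z = - `|(n + 1 - N%:Z)%R|%N%:Z by lia.
  by apply: le_trans (wM _) _; rewrite lerDl.
apply: (@le_trans _ _ (psum r `|n|.+1)); last by rewrite lerDr.
by apply: psum_ge_term => //; lia.
Qed.

(** Green's identity, with the real factor [E] moved from [w] to [f]. *)
Lemma eigensolution_wronskian E w f n : eigensolution E w ->
  wronskian C w f n - wronskian C w f (n - 1) =
  rdot (w n) ((H f - (E%:C)%C *: f) n).
Proof.
move=> wE; have <- := green_identity C V_herm w f n.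
by rewrite wE !fctE [RHS]rdotDr rdotNr rdotZr rdotZl.
Qed.

(** [s] lists the sites crossed when walking away from [n], and [p] the bonds reached. The last
    hypothesis is squared because the sum has opposite signs in the two directions. Square
    summability of [f] bounds the sum of the squared Wronskians over the bonds, which is what
    [average_bound] asks for. *)
Lemma wronskian_average E e f w n c M (s p : nat -> int) :
  0 <= c -> entry_bound c C -> l2 f -> near_eigenvector H E e f -> 0 < e <= 1 ->
  injective s -> injective p ->
  (forall N, rdot (w (s N)) (w (s N)) <= M) ->
  (forall N, rdot (w (p N)) (w (p N)) <= M) ->
  (forall N, rdot (w (p N + 1)) (w (p N + 1)) <= M) ->
  (forall N, (wronskian C w f (p N) - wronskian C w f n) ^+ 2 =
     (\sum_(i < N.+1) rdot (w (s i)) ((H f - (E%:C)%C *: f) (s i))) ^+ 2) ->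
  wronskian C w f n ^+ 2 <= e * (2 * (2 * (m%:R * (m%:R * c)) * (M * (2 * ip f f)))
                                 + 4 * (M * ip f f)).
Proof.
move=> c0 Cc lf fe e01 sI pI wsM wpM wqM wr.
have M0 : 0 <= M := le_trans (rdot_ge0 _) (wsM 0%N).
have F0 := ip_ge0 lf.
have lg : l2 (H f - (E%:C)%C *: f) by apply: l2B (l2Z _ lf); exact: l2_strip_op.
apply: (average_bound (y := fun N => wronskian C w f (p N) ^+ 2)) => //.
- exact: mulr_ge0.
- by rewrite !mulr_ge0.
- move=> N; rewrite -[X in X ^+ 2 <= _](subKr (wronskian C w f (p N))).
  apply: sqr_sub_le => //; rewrite wr -ip_restrict //.
  (* The test vector is the truncation of [w] to [N + 1] sites, which is in [l2] even when [w] is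
     not. *)
  apply: le_trans (fe _ (l2_restrict _ _ _)) _.
  rewrite ler_wpM2l ?sqr_ge0 // mulrA ler_wpM2r // ip_restrict_restrict //.
  by apply: sum_ord_le => i.
- move=> N; apply: (@le_trans _ _ (\sum_(i < N) 2 * (m%:R * (m%:R * c)) *
     (M * (rdot (f (p i)) (f (p i)) + rdot (f (p i + 1)) (f (p i + 1)))))).
    apply: ler_sum => i _; apply: le_trans (wronskian_sqr_le _ _ _ Cc) _.
    rewrite ler_wpM2l ?mulr_ge0 // addrC mulrDr; apply: lerD.
      by rewrite ler_wpM2r // rdot_ge0.
    by rewrite ler_wpM2r // rdot_ge0.
  rewrite -!mulr_sumr ler_wpM2l ?mulr_ge0 // ler_wpM2l // big_split /=.
  (* The factor 2 of [2 * ip f f]: a site may be the left end of one bond and the right end of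
     another. *)
  rewrite mulr_natl mulr2n; apply: lerD; first exact: sum_rdot_le_ip.
  apply: (@sum_rdot_le_ip _ _ (fun i => p i + 1)) => // i j /addIr; exact: pI.
Qed.

(** [K] depends on [w] and [n] but not on [e] or [f], so that the bounds for several solutions can
    be applied to one and the same [f]. *)
Lemma wronskian_half_line E w n : eigensolution E w -> bounded_on_half_line w ->
  exists2 K, 0 <= K & forall e f, 0 < e <= 1 -> l2 f -> near_eigenvector H E e f ->
    wronskian C w f n ^+ 2 <= K * (e * ip f f).
Proof.
move=> wE wb; have [c c0 Cc] := entry_bound_ex C.
have [M M0 wM] := half_line_bound n wb.
exists (2 * (2 * (m%:R * (m%:R * c)) * (M * 2)) + 4 * M).
  by rewrite addr_ge0 ?mulr_ge0.
move=> e f e01 lf fe.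
rewrite (_ : _ * (e * _) = e * (2 * (2 * (m%:R * (m%:R * c)) * (M * (2 * ip f f)))
                                 + 4 * (M * ip f f))); last by ring.
pose g := H f - (E%:C)%C *: f.
have step k := eigensolution_wronskian f k wE.
case: wM => wM.
- apply: (wronskian_average (s := fun i => n + i.+1%:Z)
    (p := fun i => n + i.+1%:Z) c0 Cc lf fe e01).
  + by move=> i j; lia.
  + by move=> i j; lia.
  + by move=> N; exact: (wM N.+1).
  + by move=> N; exact: (wM N.+1).
  + by move=> N; rewrite (_ : n + N.+1%:Z + 1 = n + N.+2%:Z); [exact: (wM N.+2)|lia].
  + move=> N; congr (_ ^+ 2); elim: N => [|N IH].
      by rewrite big_ord1 -step addrK.
    rewrite big_ord_recr -IH -step /=.
    rewrite (_ : n + N.+2%:Z - 1 = n + N.+1%:Z); last by lia.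
    by rewrite addrC addrA subrK.
(* Walking left from the bond at [n] crosses the site [n] first: the sites start at [n] and the
   bonds at [n - 1]. *)
- apply: (wronskian_average (s := fun i => n - i%:Z) (p := fun i => n - i.+1%:Z) c0 Cc lf fe e01).
  + by move=> i j; lia.
  + by move=> i j; lia.
  + by move=> N; rewrite (_ : n - N%:Z = n + 1 - N.+1%:Z); [exact: wM|lia].
  + by move=> N; rewrite (_ : n - N.+1%:Z = n + 1 - N.+2%:Z); [exact: wM|lia].
  + by move=> N; rewrite (_ : n - N.+1%:Z + 1 = n + 1 - N.+1%:Z); [exact: wM|lia].
  + move=> N; rewrite -[LHS]sqrrN opprB; congr (_ ^+ 2); elim: N => [|N IH].
      by rewrite big_ord1 subr0 -step.
    rewrite big_ord_recr -IH -step /=.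
    rewrite (_ : n - N.+1%:Z - 1 = n - N.+2%:Z); last by lia.
    by rewrite addrA subrK.
Qed.

End half_line_solutions.

(** * First moments of finite measures carried by a bounded interval *)

Section first_moment.
Context {R : realType}.
Local Notation TR := (measurableTypeR R).
Let idR : TR -> R := fun x => x.
Implicit Types mu : {measure set TR -> \bar R}.

Lemma integrable_id_bounded_support mu (a b : R) :
  (mu setT < +oo)%E -> mu (~` `[a, b]) = 0%E ->
  mu.-integrable setT (EFin \o idR).
Proof.
move=> mufin mu0.
have mab : measurable (~` `[a, b] : set TR) by apply: measurableC.
have mid := (@measurable_EFinP _ TR R setT idR).2 (@measurable_id _ TR setT).
apply/(negligible_integrable mab measurableT mid mu0).
rewrite setTD setCK; apply: measurable_bounded_integrable => //.
- by apply: le_lt_trans mufin; apply: le_measure; rewrite ?inE.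
- exact: (@measurable_id _ TR).
- rewrite /bounded_near; near=> M => x /=; rewrite in_itv /= => /andP[ax xb].
  apply: (@le_trans _ _ (Num.max `|a| `|b|)); last by near: M; exact: nbhs_pinfty_ge.
  rewrite le_max; have [x0|x0] := leP 0 x.
    by rewrite (ger0_norm x0) (le_trans xb (ler_norm b)) orbT.
  rewrite (ltr0_norm x0); apply/orP; left.
  by have := ler_norm (- a); rewrite normrN; lra.
Unshelve. all: by end_near. Qed.

Lemma first_moment_bounds mu (a b s : R) :
  mu setT = s%:E -> mu (~` `[a, b]) = 0%E ->
  a * s <= \int[mu]_x x <= b * s.
Proof.
move=> mus mu0.
have mufin : (mu setT < +oo)%E by rewrite mus ltry.
have mab : measurable (~` `[a, b] : set TR) by apply: measurableC.
have mI : measurable (`[a, b] : set TR) by [].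
have iid := integrable_id_bounded_support mufin mu0.
have muI : mu [set` `[a, b]] = s%:E.
  rewrite -mus -(setUv [set` `[a, b]]) measureU //; last by rewrite setICr.
  by rewrite [X in _ = (_ + X)%E]mu0 adde0.
have e : \int[mu]_x x = \int[mu]_(x in `[a, b]) x.
  rewrite /Rintegral (negligible_integral mab measurableT iid mu0).
  by rewrite setTD setCK.
have icst r : mu.-integrable `[a, b] (EFin \o cst r).
  apply: measurable_bounded_integrable => //; last exact: bounded_cst.
  by rewrite [X in (X < _)%E]muI ltry.
have iI : mu.-integrable `[a, b] (EFin \o idR).
  by apply: integrableS iid.
have cstE r : \int[mu]_(x in `[a, b]) r = r * s.
  by rewrite Rintegral_cst // [X in fine X]muI.
rewrite e -(cstE a) -(cstE b); apply/andP; split.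
  by apply: (le_Rintegral mI (icst a) iI) => x /=; rewrite in_itv /= => /andP[].
by apply: (le_Rintegral mI iI (icst b)) => x /=; rewrite in_itv /= => /andP[].
Qed.

(** [Rintegral] applies [fine], so additivity requires finite moments; finite mass and bounded
    support provide them. *)
Lemma first_momentD mu mu1 mu2 (a b : R) :
  (mu1 setT < +oo)%E -> (mu2 setT < +oo)%E ->
  mu1 (~` `[a, b]) = 0%E -> mu2 (~` `[a, b]) = 0%E ->
  (forall B, measurable B -> mu B = (mu1 B + mu2 B)%E) ->
  \int[mu]_x x = \int[mu1]_x x + \int[mu2]_x x.
Proof.
move=> f1 f2 s1 s2 e.
have i1 := integrable_id_bounded_support f1 s1.
have i2 := integrable_id_bounded_support f2 s2.
rewrite /Rintegral (eq_measure_integral (measure_add mu1 mu2)); last first.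
  by move=> A mA _; rewrite [RHS]measure_addE; exact: e.
rewrite integral_measure_add // fineD //; exact: integrable_fin_num.
Qed.

End first_moment.

(** * Spectral projections of a bounded interval and the quadratic form of [H] *)

Section spectral_resolution.
Context {R : realType} {m : nat}.
Local Notation seqZ := (int -> 'cV[Cx R]_m).
Local Notation borel := (set (measurableTypeR R)).
Context (H : seqZ -> seqZ) (P : borel -> seqZ -> seqZ).
Context (H_l2 : forall u, l2 u -> l2 (H u)).
Context (HD : forall u v, H (u + v) = H u + H v).
Context (HZ : forall (t : R) u, H ((t%:C)%C *: u) = (t%:C)%C *: H u).
Context (H_sym : forall u v, l2 u -> l2 v -> ip u (H v) = ip (H u) v).
Context (PH : spectral_resolution H P).
Implicit Types (u v f h : seqZ) (A B : borel).

Lemma pvm_l2 B u : measurable B -> l2 u -> l2 (P B u).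
Proof. by move=> mB lu; case: PH.1 => /(_ _ mB) [+ _ _ _] _ _ _; exact. Qed.

Lemma pvm_sym B u v : measurable B -> l2 u -> l2 v -> l2dot (P B u) v = l2dot u (P B v).
Proof. by move=> mB lu lv; case: PH.1 => /(_ _ mB) [_ _ _ +] _ _ _; exact. Qed.

Lemma pvm_ip_sym B u v : measurable B -> l2 u -> l2 v -> ip (P B u) v = ip u (P B v).
Proof. by move=> mB lu lv; rewrite /ip pvm_sym. Qed.

Lemma pvm_idem B u : measurable B -> l2 u -> P B (P B u) = P B u.
Proof. by move=> mB lu; case: PH.1 => /(_ _ mB) [_ _ + _] _ _ _; exact. Qed.

Lemma pvmD B u v : measurable B -> l2 u -> l2 v -> P B (u + v) = P B u + P B v.
Proof.
move=> mB lu lv; case: PH.1 => /(_ _ mB) [_ + _ _] _ _ _.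
by move=> /(_ 1 u v lu lv); rewrite !scale1r.
Qed.

Lemma pvmB B u v : measurable B -> l2 u -> l2 v -> P B (u - v) = P B u - P B v.
Proof.
move=> mB lu lv; case: PH.1 => /(_ _ mB) [_ + _ _] _ _ _.
by move=> /(_ (-1) v u lv lu); rewrite !scaleN1r ![- _ + _]addrC.
Qed.

Lemma pvm_set0 u : l2 u -> P set0 u = 0.
Proof. by move=> lu; case: PH.1 => _ [+ _] _ _; exact. Qed.

Lemma pvmI A B u : measurable A -> measurable B -> l2 u ->
  P (A `&` B) u = P A (P B u).
Proof. by move=> mA mB lu; case: PH.1 => _ _ _; exact. Qed.

Lemma pvm_bounded : exists a : R, forall u, l2 u -> P [set` `](- a), a[] u = u.
Proof. by case: PH.1 => _ [_ +] _ _; exact. Qed.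

(** [P] is normalised on some bounded interval [I], and [P setT u = P setT (P I u) = P I u = u]. *)
Lemma pvm_setT u : l2 u -> P setT u = u.
Proof.
move=> lu; have [a Pa] := pvm_bounded.
by rewrite -{1}(Pa _ lu) -pvmI // setTI Pa.
Qed.

Lemma pvm_disjoint A B u : measurable A -> measurable B -> A `&` B = set0 ->
  l2 u -> P B u = u -> P A u = 0.
Proof. by move=> mA mB AB lu Bu; rewrite -Bu -pvmI // AB pvm_set0. Qed.

Lemma ip_scalar_measure u : l2 u ->
  exists2 mu : {measure set (measurableTypeR R) -> \bar R},
    (forall B, measurable B -> mu B = (ip u (P B u))%:E) &
    ip u (H u) = \int[mu]_x x.
Proof.
move=> /PH.2[mu muP e]; exists mu; first exact: muP.
by rewrite /ip e.
Qed.

(** The scalar measure of [u] has mass [ip u u] and is carried by [[a, b]]; its first moment is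
    [ip u (H u)]. *)
Lemma ip_pvm_bounds (a b : R) B u : measurable B -> B `<=` `[a, b]%classic ->
  l2 u -> P B u = u -> a * ip u u <= ip u (H u) <= b * ip u u.
Proof.
move=> mB Bab lu Bu; have [mu muP ->] := ip_scalar_measure lu.
apply: first_moment_bounds; first by rewrite muP // pvm_setT.
have mab : measurable (~` `[a, b] : borel) by apply: measurableC.
rewrite muP // (pvm_disjoint mab mB) ?ip0r //.
by apply/seteqP; split => // x [/= xab /Bab].
Qed.

(* The two spectral measures add up because the cross terms cancel. *)
Lemma ip_pvm_orthogonal B u v : measurable B -> l2 u -> l2 v ->
  P B u = 0 -> P B v = v -> ip u (H v) = 0.
Proof.
move=> mB lu lv Bu Bv; have luv := l2D lu lv.
have [mu muP e] := ip_scalar_measure luv.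
have [mu1 mu1P e1] := ip_scalar_measure lu.
have [mu2 mu2P e2] := ip_scalar_measure lv.
have cross A : measurable A -> ip u (P A v) = 0.
  move=> mA; rewrite -Bv -pvmI // setIC pvmI // -pvm_ip_sym //; last exact: pvm_l2.
  by rewrite Bu ipC ip0r.
have mu12 A : measurable A -> mu A = (mu1 A + mu2 A)%E.
  move=> mA; have lAu := pvm_l2 mA lu; have lAv := pvm_l2 mA lv.
  rewrite muP // mu1P // mu2P // pvmD // -EFinD; congr EFin.
  rewrite ipDl ?ipDr //; try exact: l2D.
  by rewrite cross // (ipC v (P A u)) pvm_ip_sym // cross // addr0 add0r.
have [a Pa] := pvm_bounded.
have fin (nu : {measure set (measurableTypeR R) -> \bar R}) w :
    (forall B, measurable B -> nu B = (ip w (P B w))%:E) -> l2 w ->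
    (nu setT < +oo)%E /\ nu (~` [set` `[(- a), a]]) = 0%E.
  move=> nuP lw; split; first by rewrite nuP // ltry.
  have ma : measurable (~` [set` `[(- a), a]] : borel) by apply: measurableC.
  have ma' : measurable ([set` `](- a), a[] : borel) by [].
  rewrite nuP // (pvm_disjoint ma ma') ?ip0r ?Pa //.
  apply/seteqP; split => // x [/= + xa]; apply.
  by apply: subset_itv_oo_cc.
have [f1 s1] := fin _ _ mu1P lu; have [f2 s2] := fin _ _ mu2P lv.
have := first_momentD f1 f2 s1 s2 mu12.
rewrite -e -e1 -e2 HD; have lHu := H_l2 lu; have lHv := H_l2 lv.
rewrite ipDl ?ipDr //; try exact: l2D.
rewrite (H_sym lv lu) (ipC (H v) u); lra.
Qed.

(** On the range of the projection the quadratic form of [H - E] is at most [e] times the square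
    norm in absolute value. Polarisation extends this to the bilinear form, and the component of a
    test vector orthogonal to the range contributes nothing. *)
Lemma near_eigenvector_pvm (E e : R) h : 0 < e -> l2 h ->
  near_eigenvector H E e (P [set` `](E - e), (E + e)[] h).
Proof.
move=> e0 lh0; set B := [set` _]; set f := P B h.
have mB : measurable (B : borel) by exact: measurable_itv.
have lf : l2 f by exact: pvm_l2.
have Bf : P B f = f by exact: pvm_idem.
(* From here on [f] is known only as a fixed vector of [P B], and [h] is an arbitrary test
   vector. *)
clearbody f; move=> {h lh0} h lh; set g := _ - _.
have lHf := H_l2 lf; have lEf := l2Z E lf.
have lg : l2 g by exact: l2B.
pose p := P B h; have lp : l2 p by exact: pvm_l2.
have Bp : P B p = p by exact: pvm_idem.
have lhp := l2B lh lp.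
have hg : ip h g = ip p g.
  apply/eqP; rewrite -subr_eq0 -ipBl // /g ipBr // ipZr //.
  rewrite (ip_pvm_orthogonal mB lhp lf) //; last by rewrite pvmB // Bp subrr.
  by rewrite ipBl // /p pvm_ip_sym // Bf subrr mulr0 subrr.
have pp : ip p p <= ip h h.
  have := ip_ge0 lhp; rewrite ipBl // !ipBr //.
  have -> : ip p p = ip p h by rewrite {1}/p pvm_ip_sym // Bp ipC.
  by rewrite (ipC h p); lra.
have q x : l2 x -> P B x = x -> `|ip x (H x) - E * ip x x| <= e * ip x x.
  move=> lx Bx; have := @ip_pvm_bounds (E - e) (E + e) B x mB _ lx Bx.
  move=> /(_ _)/andP[|b1 b2]; first exact: subset_itv_oo_cc.
  by rewrite ler_norml; apply/andP; split; lra.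
(* Subtract the lower bound of [q] at [x - y] from the upper bound at [x + y], and use the
   parallelogram identity. *)
have polar x y : l2 x -> l2 y -> P B x = x -> P B y = y ->
    2 * (ip x (H y) - E * ip x y) <= e * (ip x x + ip y y).
  move=> lx ly Bx By; have lHx := H_l2 lx; have lHy := H_l2 ly.
  have := q _ (l2D lx ly); have := q _ (l2B lx ly).
  rewrite pvmB // pvmD // Bx By => /(_ erefl) + /(_ erefl).
  have -> : H (x - y) = H x - H y by rewrite -scaler_realN1 HD HZ scaler_realN1.
  have lxy := l2D lx ly; have lxy' := l2B lx ly.
  rewrite HD (ipBr lxy' lHx lHy) (ipBr lxy' lx ly) !(fun w lw => @ipBl _ _ w x y lw lx ly) //.
  rewrite (ipDr lxy lHx lHy) (ipDr lxy lx ly) !(fun w lw => @ipDl _ _ w x y lw lx ly) //.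
  rewrite (H_sym ly lx) (ipC (H y) x) (ipC y x).
  rewrite !ler_norml => /andP[h1 _] /andP[_ h2].
  move: h1 h2; generalize (ip x (H x)) (ip x (H y)) (ip y (H y)) (ip x x) (ip x y) (ip y y).
  by move=> *; lra.
rewrite hg.
apply: (@le_trans _ _ ((e * ip p p) * (e * ip f f))).
  (* [polar] at [t p] and [f], for all real [t], is the quadratic inequality whose discriminant
     gives the Cauchy-Schwarz form of the bound. *)
  apply: sqr_le_mul_of_quadratic; first by rewrite mulr_ge0 ?ip_ge0 // ltW.
  move=> t; have ltp := l2Z t lp; have lHp := H_l2 lp.
  have Btp : P B ((t%:C)%C *: p) = (t%:C)%C *: p.
    have [/(_ _ mB)[_ + _ _] _ _ _] := PH.1.
    move=> /(_ (t%:C)%C p 0 lp l2_0); rewrite !addr0 Bp => ->.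
    by rewrite (_ : P B 0 = 0) ?addr0 //; have := pvmB mB l2_0 l2_0; rewrite !subrr.
  have := polar _ _ ltp lf Btp Bf.
  rewrite /g ipBr // !ipZl // !ipZr //.
  generalize (ip p (H f)) (ip p f) (ip p p) (ip f f) => *; lra.
rewrite mulrACA -expr2 ler_wpM2l ?sqr_ge0 // ler_wpM2r // ip_ge0 //.
Qed.

End spectral_resolution.

(** * Measures with a density bound on Lebesgue-null sets *)

Section density.
Context {R : realType}.
Local Notation borel := (set (measurableTypeR R)).
Implicit Types (mu : {measure set (measurableTypeR R) -> \bar R}) (S : borel).

Definition density_le mu (k : R) : borel :=
  [set E : R | forall e : R, 0 < e <= 1 ->
    (mu [set` `](E - e), (E + e)[%R] <= (k * e)%:E)%E].

(** Cover [S] by half-open intervals of total length below [d] and keep those that meet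
    [density_le mu k]. The density bound at a point of a kept interval controls its mass by [2 k]
    times its length. *)
Lemma density_le_small_cover mu k S (d : R) : 0 <= k -> 0 < d <= 2^-1 ->
  (@lebesgue_measure R) S = 0%E ->
  exists G : borel, [/\ measurable G, S `&` density_le mu k `<=` G &
                        (mu G <= (2 * k * d)%:E)%E].
Proof.
move=> k0 /andP[d0 d1] S0.
(* Lebesgue measure is the outer measure built from lengths of half-open intervals, so its infimum
   yields the cover [A]. *)
have : (mu_ext (wlength idfun) (S : set (ocitv_type R)) < d%:E)%E.
  by rewrite [X in (X < _)%E]S0 lte_fin.
move=> /ereal_inf_lt[_ [A [mA SA] <-] Ad].
have A0 n : (0 <= wlength idfun (A n))%E by exact: wlength_ge0.
(* Each interval is kept whole or dropped, so [I n] is measurable whether or not [density_le mu k]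
   is. *)
pose I n : borel := [set x | A n x /\ exists2 E, A n E & density_le mu k E].
have IE n : I n = set0 \/ I n = A n /\ exists2 E, A n E & density_le mu k E.
  have [h|h] := pselect (exists2 E, A n E & density_le mu k E).
    by right; split => //; apply/seteqP; split => [x []|].
  by left; rewrite -subset0 => x [_ /h].
have mI n : measurable (I n).
  case: (IE n) => [-> //|[-> _]]; apply: sub_sigma_algebra; exact: mA.
have Ile n : (mu (I n) <= (2 * k)%:E * wlength idfun (A n))%E.
  case: (IE n) => [->|[-> [E AE DE]]].
    by rewrite measure0 mule_ge0 // lee_fin mulr_ge0.
  have [[x y] _ Axy] := mA n; move: AE; rewrite -Axy /= in_itv /= => /andP[xE Ey].
  have xy : x <= y by rewrite (le_trans (ltW xE)).
  have lA : wlength idfun `]x, y]%classic = (y - x)%:E by rewrite wlength_itv_bnd.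
  have ld : y - x < d.
    rewrite -lte_fin -lA [`]x, y]%classic]Axy; apply: le_lt_trans Ad.
    rewrite (@nneseriesD1 _ _ n xpredT) // leeDl //.
    by apply: nneseries_ge0 => ? _ _; exact: A0.
  rewrite [X in (_ <= _ * X)%E]lA.
  (* The interval of radius [2 (y - x)] around [E] contains []x, y]], and [d <= 1 / 2] keeps this
     radius at most 1, as [density_le] demands. *)
  apply: (@le_trans _ _ (mu [set` `](E - 2 * (y - x)), (E + 2 * (y - x))[])).
    apply: le_measure; rewrite ?inE //.
    move=> z /=; rewrite !in_itv /= => /andP[xz zy].
    by apply/andP; split; lra.
  apply: le_trans (DE _ _) _; first by apply/andP; split; lra.
  by rewrite -EFinM lee_fin; lra.
exists (\bigcup_n I n); split.
- exact: bigcup_measurable.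
- move=> x [Sx Dx]; have [n _ Ax] := SA _ Sx; exists n => //; split => //.
  by exists x.
- apply: le_trans (measure_sigma_subadditive _ _ _ _) _ => //.
    exact: bigcup_measurable.
  apply: le_trans (lee_nneseries _ (fun n _ => Ile n)) _ => //.
  rewrite nneseriesZl ?lee_fin ?mulr_ge0 //.
  by rewrite [leRHS]EFinM lee_wpmul2l ?lee_fin ?mulr_ge0 // ltW.
Qed.

Lemma density_le_null_cover mu k S : 0 <= k -> (@lebesgue_measure R) S = 0%E ->
  exists G : borel, [/\ measurable G, S `&` density_le mu k `<=` G & mu G = 0%E].
Proof.
move=> k0 S0.
have n01 (n : nat) : 0 < (n.+2%:R^-1 : R) <= 2^-1.
  rewrite invr_gt0 ltr0n /= lef_pV2 ?posrE ?ltr0n //.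
  by rewrite ler_nat.
have /choice[G GP] := fun n => density_le_small_cover mu k0 (n01 n) S0.
exists (\bigcap_n G n); split.
- by apply: bigcap_measurableType => n _; case: (GP n).
- by move=> x Sx n _; case: (GP n) => _ + _; exact.
- apply/eqP; rewrite eq_le measure_ge0 andbT; apply/lee_addgt0Pr => e e0.
  rewrite add0e.
  pose n := Num.truncn (2 * k / e).
  have [mG _ mu_le] := GP n.
  apply: le_trans (le_trans _ mu_le) _.
    apply: le_measure; rewrite ?inE //; last by move=> x; exact.
    by apply: bigcap_measurableType => j _; case: (GP j).
  rewrite lee_fin ler_pdivrMr ?ltr0n //.
  have : 2 * k / e < n.+1%:R by exact: truncnS_gt.
  rewrite ltr_pdivrMr // => /ltW/le_trans; apply.
  by rewrite mulrC ler_wpM2l ?ltW // ltr_nat.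
Qed.

(** [density_le mu k] grows with [k], so the covers for integer constants suffice, and their
    countable union is a null set serving all constants. *)
Lemma density_null_cover mu S : (@lebesgue_measure R) S = 0%E ->
  exists G : borel, [/\ measurable G, mu G = 0%E &
    forall E k, S E -> density_le mu k E -> G E].
Proof.
move=> S0.
have /choice[G GP] := fun n : nat => density_le_null_cover mu (ler0n R n) S0.
exists (\bigcup_n G n); split.
- by apply: bigcup_measurable => n _; case: (GP n).
- apply: measure_negligible; first by apply: bigcup_measurable => n _; case: (GP n).
  by apply: negligible_bigcup => n; case: (GP n) => mG _ G0; apply/negligibleP.
- move=> E k SE Ek; exists (Num.truncn `|k|).+1 => //.
  case: (GP (Num.truncn `|k|).+1) => _ + _; apply; split => // e /andP[e0 e1].
  apply: le_trans (Ek e _) _; first by rewrite e0 e1.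
  rewrite lee_fin ler_wpM2r ?ltW // (le_lt_trans (ler_norm k)) //.
  exact: truncnS_gt.
Qed.

End density.

(** * Uniform bounds on the potential, and solutions generated by the cocycle *)

Lemma invmxM (F : comUnitRingType) d (A B : 'M[F]_d) :
  A \in unitmx -> B \in unitmx -> invmx (A *m B) = invmx B *m invmx A.
Proof.
move=> uA uB; have uAB : A *m B \in unitmx by rewrite unitmx_mul uA.
apply: (can_inj (mulKmx uAB)).
by rewrite mulmxV // -mulmxA mulKVmx // mulmxV.
Qed.

Lemma hermsymmxE (R : realType) m (A : 'M[Cx R]_m) : A \is hermsymmx -> A^t* = A.
Proof. by move=> /is_hermitianmxP; rewrite expr0 scale1r => <-. Qed.

(** Near each point, all large [N] bound the entries; compactness in its near-covering form then
    yields one [N] for all points. *)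
Lemma continuous_entry_bound (R : realType) (Omega : metricType R) m
    (V : Omega -> 'M[Cx R]_m) : compact [set: Omega] -> continuous V ->
  exists b, forall w, entry_bound b (V w).
Proof.
move=> /compact_near_coveringP cO cV.
have : \forall N \near \oo, [set: Omega] `<=`
    (fun w => forall i j, `|V w i j| <= N%:R).
  apply: cO => w _.
  have near_w : \forall w' \near w, forall i j, `|V w i j - V w' i j| < 1.
    apply: filter_forall => i; apply: filter_forall => j.
    apply: (cvgr_dist_lt (fun w' => V w' i j) (V w i j)) => //.
    apply: (@continuous_comp _ _ _ V (fun M : 'M[Cx R]_m => M i j)); first exact: cV.
    exact: coord_continuous.
  pose B := \sum_i \sum_j complex.Re `|V w i j|.
  have VB i j : `|V w i j| <= (B%:C)%C.
    have -> : `|V w i j| = ((complex.Re `|V w i j|)%:C)%C.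
      by rewrite RRe_real // normr_real.
    have p0 k l : 0 <= complex.Re `|V w k l|.
      by case: (V w k l) => x y /=; exact: sqrtr_ge0.
    rewrite lecR /B (bigD1 i) //= (bigD1 j) //= -addrA lerDl.
    apply: addr_ge0; first by apply: sumr_ge0 => l _; exact: p0.
    by apply: sumr_ge0 => k _; apply: sumr_ge0 => l _; exact: p0.
  exists ([set w' | forall i j, `|V w i j - V w' i j| < 1],
          [set N : nat | B + 1 <= N%:R]).
    split => //=; near=> N; near: N; exact: nbhs_infty_ger.
  move=> [w' N] [/= ww' BN] i j.
  have -> : V w' i j = V w i j - (V w i j - V w' i j) by rewrite subKr.
  apply: le_trans (ler_normB _ _) _.
  apply: le_trans (lerD (VB i j) (ltW (ww' i j))) _.
  have -> : N%:R = ((N%:R : R)%:C)%C by rewrite rmorph_nat.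
  by rewrite -[1]/((1%:C)%C) -rmorphD lecR.
move=> [N _ /(_ N (leqnn N)) VN]; exists (N%:R ^+ 2) => w i j.
have := VN w I i j; case: (V w i j) => x y /=.
have -> : N%:R = ((N%:R : R)%:C)%C :> Cx R by rewrite rmorph_nat.
rewrite [`|_|]/(((Num.sqrt (x ^+ 2 + y ^+ 2))%:C)%C) lecR => h.
rewrite -[X in X <= _]sqr_sqrtr ?addr_ge0 ?sqr_ge0 //.
by rewrite ler_sqr ?nnegrE ?sqrtr_ge0.
Unshelve. all: by end_near. Qed.

Section cocycle_solutions.
Context {R : realType} {Omega : metricType R} (T Tinv : Omega -> Omega).
Context (TinvK : cancel Tinv T).

Section general_cocycle.
Context {d : nat} (A : Omega -> 'M[Cx R]_d) (A_unit : forall w, A w \in unitmx).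

Lemma cocycle_nat_unit n w : cocycle_nat T A n w \in unitmx.
Proof. by elim: n => [|n IH] /=; rewrite ?unitmx1 // unitmx_mul A_unit. Qed.

Lemma cocycle_natSr n w : cocycle_nat T A n.+1 w = cocycle_nat T A n (T w) *m A w.
Proof.
elim: n => [|n IH]; first by rewrite /= mulmx1 mul1mx.
by rewrite [LHS]/= [X in _ *m X]IH mulmxA -iterS iterSr.
Qed.

Lemma cocycle_unit n w : cocycle T Tinv A n w \in unitmx.
Proof. by case: n => n; rewrite /cocycle ?unitmx_inv; exact: cocycle_nat_unit. Qed.

Lemma iter_invK n w : iter n T (iter n Tinv w) = w.
Proof. by elim: n => //= n IH; rewrite -iterS iterSr /= TinvK. Qed.

(** For negative [n], the new factor cancels the inverse of the first factor of the product that
    defines the backward iterate. *)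
Lemma cocycleS n w :
  cocycle T Tinv A (n + 1) w = A (iterz T Tinv n w) *m cocycle T Tinv A n w.
Proof.
case: n => n; first by rewrite (_ : _ + 1 = n.+1%:Z) //; lia.
rewrite [cocycle _ _ _ (Negz n) w]/cocycle cocycle_natSr invmxM ?cocycle_nat_unit //.
rewrite mulKVmx // /iterz iterS TinvK.
case: n => [|n]; first by rewrite (_ : Negz 0 + 1 = 0%:Z) //= invmx1.
by rewrite (_ : Negz n.+1 + 1 = Negz n) //; lia.
Qed.

End general_cocycle.

Context {m : nat} (C : 'M[Cx R]_m) (C_unit : C \in unitmx).
Context (V : Omega -> 'M[Cx R]_m) (E : R) (w : Omega).
Local Notation A := (schrodinger_cocycle C V E).
Local Notation coc := (cocycle T Tinv A).
Local Notation H := (strip_op C (fun n => V (iterz T Tinv n w))).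

Lemma adj_unitmx (D : 'M[Cx R]_m) : D \in unitmx -> D^t* \in unitmx.
Proof. by move=> uD; rewrite map_unitmx unitmx_tr. Qed.

Lemma schrodinger_cocycle_unit x : A x \in unitmx.
Proof.
pose K := invmx C *m C^t*; pose L := invmx C *m ((E%:C)%C%:M - V x).
have uK : K \in unitmx by rewrite unitmx_mul unitmx_inv C_unit adj_unitmx.
have := @mulmx1_unit _ _ (A x) (block_mx 0 1%:M (- invmx K) (invmx K *m L)).
case=> //.
rewrite /schrodinger_cocycle -/K -/L mulmx_block !mulmx0 !mul0mx !mul1mx !add0r !addr0.
rewrite mulmxN mulNmx opprK mulmxV // mulmx1 mulNmx mulKVmx // subrr.
by rewrite -scalar_mx_block.
Qed.

(** At time [n] the cocycle orbit of [z] is the column of the values at sites [n] and [n - 1]; thus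
    [z] holds the data at sites 0 and -1. *)
Definition cocycle_solution (z : 'cV[Cx R]_(m + m)) (n : int) : 'cV[Cx R]_m :=
  usubmx (coc n w *m z).

Lemma cocycle_col n z : coc (n + 1) w *m z =
  col_mx (cocycle_solution z (n + 1)) (cocycle_solution z n).
Proof.
rewrite -[LHS]vsubmxK; congr col_mx.
rewrite cocycleS; last exact: schrodinger_cocycle_unit.
rewrite -mulmxA -{1}(vsubmxK (coc n w *m z)) mul_block_col col_mxKd.
by rewrite mul1mx mul0mx addr0.
Qed.

Lemma cocycle_solution_rec z n : C *m cocycle_solution z (n + 1) =
  ((E%:C)%C%:M - V (iterz T Tinv n w)) *m cocycle_solution z n
  - C^t* *m cocycle_solution z (n - 1).
Proof.
rewrite {1}/cocycle_solution cocycleS; last exact: schrodinger_cocycle_unit.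
rewrite -mulmxA; have := cocycle_col (n - 1) z; rewrite subrK => ->.
rewrite mul_block_col col_mxKu.
have e (X Y : 'M[Cx R]_m) (x y : 'cV[Cx R]_m) :
    C *m (invmx C *m X *m x + - (invmx C *m Y) *m y) = X *m x - Y *m y.
  by rewrite mulmxDr mulNmx mulmxN -!mulmxA !mulKVmx.
exact: e.
Qed.

Lemma cocycle_solution_eigen z :
  eigensolution C (fun n => V (iterz T Tinv n w)) E (cocycle_solution z).
Proof.
apply/funext => n; rewrite /strip_op cocycle_solution_rec fctE.
by rewrite mulmxBl mul_scalar_mx [_ - _ + _]addrAC addrNK subrK.
Qed.

(** Invertibility lets data be prescribed at sites [n] and [n + 1]. This choice makes the Wronskian
    with any [f] at [n] equal to [- rdot x (f n)]. *)
Lemma cocycle_solution_data n x : exists z,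
  cocycle_solution z n = 0 /\ C *m cocycle_solution z (n + 1) = x.
Proof.
exists (invmx (coc (n + 1) w) *m col_mx (invmx C *m x) 0).
set y := col_mx _ _; set z := _ *m y.
have zy : coc (n + 1) w *m z = y.
  by rewrite /z mulKVmx //; apply: cocycle_unit; exact: schrodinger_cocycle_unit.
have := cocycle_col n z; rewrite zy => /eq_col_mx[<- <-].
by rewrite mulKVmx.
Qed.

Lemma cocycle_solutionD z1 z2 :
  cocycle_solution (z1 + z2) = cocycle_solution z1 + cocycle_solution z2.
Proof. by apply/funext => n; rewrite /cocycle_solution mulmxDr linearD. Qed.

Lemma rdot_usubmx_le (x : 'cV[Cx R]_(m + m)) : rdot (usubmx x) (usubmx x) <= rdot x x.
Proof.
rewrite -{3 4}(vsubmxK x) [leRHS]rdotE big_split_ord /=.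
under eq_bigr do rewrite !col_mxEu.
under [X in _ + X]eq_bigr do rewrite !col_mxEd.
by rewrite -!rdotE lerDl rdot_ge0.
Qed.

Lemma rdot_cocycle_solution_le z n :
  rdot (cocycle_solution z n) (cocycle_solution z n) <= vnorm (coc n w *m z) ^+ 2.
Proof. by rewrite sqr_vnorm; exact: rdot_usubmx_le. Qed.

End cocycle_solutions.

(** * From three half-line bounded solutions to a density bound *)

Lemma wronskianDl (R : realType) (m : nat) (C : 'M[Cx R]_m)
    (u v f : int -> 'cV[Cx R]_m) n :
  wronskian C (u + v) f n = wronskian C u f n + wronskian C v f n.
Proof. by rewrite /wronskian !fctE mulmxDr !rdotDl addrACA opprD. Qed.

Lemma density_le_of_solutions (R : realType) (m : nat) (C : 'M[Cx R]_m)
    (V : int -> 'M[Cx R]_m) (b : R) P (n : int) (x : 'cV[Cx R]_m) (E : R)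
    (w1 w2 w3 : int -> 'cV[Cx R]_m)
    (mu : {measure set (measurableTypeR R) -> \bar R}) :
  (forall k, (V k)^t* = V k) -> (forall k, entry_bound b (V k)) ->
  spectral_resolution (strip_op C V) P ->
  eigensolution C V E w1 -> eigensolution C V E w2 -> eigensolution C V E w3 ->
  bounded_on_half_line w1 -> bounded_on_half_line w2 -> bounded_on_half_line w3 ->
  (w1 + w2 + w3) n = 0 -> C *m (w1 + w2 + w3) (n + 1) = x ->
  (forall B, measurable B -> mu B = (ip (delta n x) (P B (delta n x)))%:E) ->
  exists k, density_le mu k E.
Proof.
move=> V_herm Vb PH e1 e2 e3 b1 b2 b3 wn wn1 muP.
have [K1 K10 h1] := wronskian_half_line V_herm Vb n e1 b1.
have [K2 K20 h2] := wronskian_half_line V_herm Vb n e2 b2.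
have [K3 K30 h3] := wronskian_half_line V_herm Vb n e3 b3.
have H_l2 u : l2 u -> l2 (strip_op C V u) by exact: l2_strip_op Vb.
have HD := strip_opD C V; have HZ := strip_opZ C V.
have H_sym u v : l2 u -> l2 v -> ip u (strip_op C V v) = ip (strip_op C V u) v.
  exact: strip_op_sym Vb.
(* The square of a sum of three reals is at most 3, hence 4, times the sum of their squares. With
   [F = ip f f] this gives [F ^+ 2 <= k * (e * F)], and one factor [F] is divided out. *)
exists (4 * (K1 + K2 + K3)) => e e01; have /andP[e0 _] := e01.
have ld := l2_delta n x.
pose B := [set` `](E - e), (E + e)[] : set (measurableTypeR R).
have mB : measurable B by exact: measurable_itv.
pose f := P B (delta n x).
have lf : l2 f by exact: pvm_l2 PH _ _ mB ld.
have fe : near_eigenvector (strip_op C V) E e f.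
  exact: near_eigenvector_pvm H_l2 HD HZ H_sym PH _ _ _ e0 ld.
rewrite muP // -/f lee_fin.
have F2 : ip (delta n x) f = ip f f.
  by rewrite [in RHS]/f (pvm_ip_sym PH mB ld lf) (pvm_idem PH mB ld).
have W : - ip f f = wronskian C w1 f n + wronskian C w2 f n + wronskian C w3 f n.
  rewrite -F2 ip_delta -wn1.
  have -> : wronskian C w1 f n + wronskian C w2 f n + wronskian C w3 f n =
            wronskian C (w1 + w2 + w3) f n.
    by rewrite !wronskianDl.
  by rewrite /wronskian wn rdot0l sub0r.
have := h1 e f e01 lf fe; have := h2 e f e01 lf fe; have := h3 e f e01 lf fe.
rewrite F2; have F0 := ip_ge0 lf; move: W F0.
generalize (wronskian C w1 f n) (wronskian C w2 f n) (wronskian C w3 f n) (ip f f).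
move=> x1 x2 x3 F W F0 q3 q2 q1.
have FF : F ^+ 2 <= 4 * (K1 + K2 + K3) * (e * F).
  have : F ^+ 2 <= 4 * (x1 ^+ 2 + x2 ^+ 2 + x3 ^+ 2).
    rewrite -(sqrrN F) W.
    have := sqr_ge0 (x1 - x2); have := sqr_ge0 (x1 - x3); have := sqr_ge0 (x2 - x3).
    by have := sqr_ge0 x1; have := sqr_ge0 x2; have := sqr_ge0 x3; lra.
  by lra.
have [->|F1] := eqVneq F 0; first by rewrite !mulr_ge0 ?addr_ge0 // ltW.
have F2' : 0 < F by rewrite lt_neqAle eq_sym F1.
by rewrite -(ler_pM2r F2') -expr2 -mulrA.
Qed.

(** * Boundedness of the solutions issued from the three bundles *)

Section splitting_solutions.
Context {R : realType} {Omega : metricType R} (T Tinv : Omega -> Omega).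
Context (TinvK : cancel Tinv T) {m : nat} (C : 'M[Cx R]_m) (V : Omega -> 'M[Cx R]_m).
Context (E : R) (w : Omega).
Local Notation A := (schrodinger_cocycle C V E).
Local Notation sol := (cocycle_solution T Tinv C V E w).

Lemma bounded_forward_solution z M :
  (forall n : nat, vnorm (cocycle_nat T A n w *m z) <= M) -> bounded_on_half_line (sol z).
Proof.
move=> zM; exists (M ^+ 2); left => n.
apply: le_trans (rdot_cocycle_solution_le _ _ _ _ _ _ _ _) _.
by rewrite ler_sqr ?nnegrE ?sqrtr_ge0 ?(le_trans _ (zM n)) ?sqrtr_ge0 //; exact: zM.
Qed.

Lemma bounded_backward_solution z M :
  (forall n : nat, vnorm (invmx (cocycle_nat T A n (iter n Tinv w)) *m z) <= M) ->
  bounded_on_half_line (sol z).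
Proof.
move=> zM; exists (M ^+ 2); right => n.
have cn : cocycle T Tinv A (- n%:Z) w = invmx (cocycle_nat T A n (iter n Tinv w)).
  by case: n => [|n] //=; rewrite invmx1.
apply: le_trans (rdot_cocycle_solution_le _ _ _ _ _ _ _ _) _.
by rewrite cn ler_sqr ?nnegrE ?sqrtr_ge0 ?(le_trans _ (zM n)) ?sqrtr_ge0 //; exact: zM.
Qed.

Lemma bounded_stable_solution (F : Omega -> {vspace 'cV[Cx R]_(m + m)}) K c z :
  0 < K -> 0 < c ->
  (forall n v, v \in F w -> vnorm (cocycle_nat T A n w *m v)
     <= K * expR (- c * n%:R) * vnorm v) ->
  z \in F w -> bounded_on_half_line (sol z).
Proof.
move=> K0 c0 h zF; apply: (@bounded_forward_solution _ (K * vnorm z)) => n.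
apply: le_trans (h n z zF) _; rewrite ler_wpM2r ?sqrtr_ge0 //.
rewrite -[leRHS]mulr1 ler_wpM2l ?(ltW K0) // -expR0 ler_expR.
by rewrite mulNr oppr_le0 mulr_ge0 // ltW.
Qed.

(** The backward contraction is used at the base point [iter n Tinv w], whose [n]-th iterate is
    [w]. *)
Lemma bounded_unstable_solution (F : Omega -> {vspace 'cV[Cx R]_(m + m)}) K c z :
  0 < K -> 0 < c ->
  (forall n x v, v \in F (iter n T x) -> vnorm (invmx (cocycle_nat T A n x) *m v)
     <= K * expR (- c * n%:R) * vnorm v) ->
  z \in F w -> bounded_on_half_line (sol z).
Proof.
move=> K0 c0 h zF; apply: (@bounded_backward_solution _ (K * vnorm z)) => n.
apply: le_trans (h n _ z _) _; first by rewrite iter_invK.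
rewrite ler_wpM2r ?sqrtr_ge0 //.
rewrite -[leRHS]mulr1 ler_wpM2l ?(ltW K0) // -expR0 ler_expR.
by rewrite mulNr oppr_le0 mulr_ge0 // ltW.
Qed.

Lemma bounded_center_solution (F : {vspace 'cV[Cx R]_(m + m)}) z :
  (ereal_sup [set opnorm_on (cocycle T Tinv A n w) F | n in [set: int]] < +oo)%E ->
  z \in F -> bounded_on_half_line (sol z).
Proof.
set S := ereal_sup _ => Soo zF.
pose r := rdot z z; have r0 : 0 <= r by exact: rdot_ge0.
(* [opnorm_on] only sees the unit ball. This factor brings [z] into it without a case distinction on
   [z = 0], as [t ^+ 2 * r <= 1]. *)
pose t := (1 + r)^-1; have t0 : 0 < t by rewrite invr_gt0 ltr_pwDl.
pose y := (t%:C)%C *: z.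
have y1 : vnorm y <= 1.
  rewrite -(ler_sqr (_ : _ \in Num.nneg)) ?nnegrE ?sqrtr_ge0 // sqr_vnorm rdotZl rdotZr -/r.
  have tr : t * (1 + r) = 1 by rewrite mulVf // gt_eqF // ltr_pwDl.
  have t1 : t <= 1 by rewrite invf_le1 ?ltr_pwDl // lerDl.
  by rewrite expr1n mulr_ile1 ?mulr_ge0 ?(ltW t0) //; lra.
have yS n : ((vnorm (cocycle T Tinv A n w *m y))%:E <= S)%E.
  apply: (@le_trans _ _ (opnorm_on (cocycle T Tinv A n w) F)); last first.
    by apply: ereal_sup_ubound; exists n.
  by apply: ereal_sup_ubound; exists y => //; split => //; exact: memvZ.
have Sfin : S \is a fin_num.
  by rewrite ge0_fin_numE // (le_trans _ (yS 0)) // lee_fin sqrtr_ge0.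
exists (t^-1 ^+ 2 * fine S ^+ 2); left => n.
apply: le_trans (rdot_cocycle_solution_le _ _ _ _ _ _ _ _) _.
have -> : z = (t^-1%:C)%C *: y.
  by rewrite /y scalerA -rmorphM mulVf ?gt_eqF // scale1r.
rewrite -scalemxAr sqr_vnorm rdotZl rdotZr mulrA -expr2 -sqr_vnorm.
rewrite ler_wpM2l ?sqr_ge0 //.
have := yS n; rewrite -[S]fineK // lee_fin => h.
by rewrite ler_sqr ?nnegrE ?sqrtr_ge0 // (le_trans _ h) ?sqrtr_ge0.
Qed.

End splitting_solutions.

(** * From density bounds at basis vectors to every spectral measure *)

Theorem theorem1p1 (R : realType) (Omega : metricType R)
  (Omega_compact : compact [set: Omega])
  (T Tinv : Omega -> Omega) (T_homeo : is_homeomorphism T Tinv)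
  (m : nat) (m_ge1 : (1 <= m)%N)
  (C : 'M[Cx R]_m) (C_unit : C \in unitmx)
  (V : Omega -> 'M[Cx R]_m) (V_cont : continuous V)
  (V_herm : forall w, V w \is hermsymmx)
  (J : set R)
  (Eu Ec Es : R -> Omega -> {vspace 'cV[Cx R]_(m + m)})
  (J_ph : forall E, J E ->
    partially_hyperbolic T (schrodinger_cocycle C V E) (Eu E) (Ec E) (Es E)) :
  forall w : Omega,
    purely_ac_on (schrodinger_operator T Tinv C V w)
      (bounded_center_set T Tinv C V J Ec w).
Proof.
move=> w u mu nu lu [P PH muP] [ac [_ [S [mS S0 nuS]] mu_split]].
have [b Vb] := continuous_entry_bound Omega_compact V_cont.
have [_ _ _ TinvK] := T_homeo.
pose Vw n := V (iterz T Tinv n w).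
have Vw_herm n : (Vw n)^t* = Vw n by exact: hermsymmxE (V_herm _).
have Vwb n : entry_bound b (Vw n) by exact: Vb.
(* [schrodinger_operator] is convertible with [strip_op] for the potential read along the orbit of
   [w]. *)
have {}PH : spectral_resolution (strip_op C Vw) P by exact: PH.
pose e (p : int * 'I_m) := delta p.1 (delta_mx p.2 0 : 'cV[Cx R]_m).
have le p : l2 (e p) by exact: l2_delta.
have /choice[mue mue_ip] : forall p, exists rho : {measure set (measurableTypeR R) -> \bar R},
    forall B, measurable B -> rho B = (ip (e p) (P B (e p)))%:E.
  by move=> p; have [rho rhoP _] := ip_scalar_measure PH (le p); exists rho.
have /choice[G GP] := fun p => density_null_cover (mue p) S0.
(* The countably many null sets [G p] are intersected along [unpickle]; numbers that code no pair
   contribute [setT]. *)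
pose G' : set (measurableTypeR R) :=
  \bigcap_(k in [set: nat]) (if unpickle k is Some p then G p else setT).
have mG' : measurable G'.
  apply: bigcap_measurableType => k _; case: unpickle => [p|]; last exact: measurableT.
  by case: (GP p).
have G'G p : G' `<=` G p.
  by move=> x /(_ (pickle p) Logic.I); rewrite pickleK.
(* The square norm of [P G' (e p)] is [mue p G'], and [G'] lies in the null set [G p]. *)
have P0 p : P G' (e p) = 0.
  apply: ip_eq0; first exact: pvm_l2 PH _ _ mG' (le p).
  rewrite (pvm_ip_sym PH) //; last exact: pvm_l2 PH _ _ mG' (le p).
  rewrite (pvm_idem PH) //; apply: EFin_inj.
  rewrite -mue_ip //.
  have [mG G0 _] := GP p.
  apply/eqP; rewrite eq_le measure_ge0 andbT -[X in (_ <= X)%E]G0.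
  by apply: le_measure; rewrite ?inE.
(* Self-adjointness moves [P G'] onto the basis vectors. The full [l2dot] is used here because each
   complex coordinate must vanish. *)
have Pu0 : P G' u = 0.
  apply/funext => n; apply/matrixP => i j; rewrite ord1 mxE.
  have := pvm_sym PH mG' (le (n, i)) lu.
  rewrite P0 l2dot_delta => h.
  have e1 : dotc (delta_mx i 0) (P G' u n) = P G' u n i 0.
    rewrite /dotc (bigD1 i) //= mxE !eqxx rmorph1 mul1r big1 ?addr0 // => k ki.
    by rewrite mxE (negbTE ki) rmorph0 mul0r.
  rewrite -e1 -h (_ : 0 = delta 0 0); last by apply/funext => k; rewrite /delta if_same.
  by rewrite l2dot_delta /dotc big1 // => k _; rewrite mxE rmorph0 mul0r.
have nuG' : nu G' = 0%E.
  apply/eqP; rewrite eq_le measure_ge0 andbT.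
  have <- : mu G' = 0%E by rewrite muP // Pu0; congr EFin; exact: ip0r.
  by rewrite mu_split // leeDr.
(* [nu] ignores the complement of [S]; at energies of [S], the density bounds place [E] in every
   [G p], hence in [G']. *)
exists (G' `|` ~` S); split.
- by apply: measurableU => //; exact: measurableC.
- apply/eqP; rewrite eq_le measure_ge0 andbT.
  apply: le_trans (measureU2 _ mG' (measurableC mS)) _.
  by rewrite [X in (X + _)%E]nuG' [X in (_ + X)%E]nuS adde0.
move=> E [JE Ebound]; have [SE|SE] := pselect (S E); last by right.
left; move=> k _; case: unpickle => [p|//].
have [_ _ GE] := GP p; suff [K EK] : exists K, density_le (mue p) K E by exact: GE EK.
have [z [z0 z1]] := cocycle_solution_data TinvK C_unit V E w p.1 (delta_mx p.2 0).
have [dir _ _ _ [K [c [K0 c0 hyp]]]] := J_ph _ JE.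
have [_ full] := dir w.
have : z \in (Eu E w + Ec E w + Es E w)%VS by rewrite full memvf.
move=> /memv_addP[_ /memv_addP[zu zuE [zc zcE ->]] [zs zsE zE]].
move: z0 z1; rewrite zE !cocycle_solutionD => z0 z1.
apply: (density_le_of_solutions Vw_herm Vwb PH _ _ _ _ _ _ z0 z1 (mue_ip p)).
- exact: cocycle_solution_eigen.
- exact: cocycle_solution_eigen.
- exact: cocycle_solution_eigen.
- apply: (bounded_unstable_solution TinvK K0 c0 _ zuE) => n x v vE.
  by have [_ h] := hyp n x; exact: h.
- exact: bounded_center_solution Ebound zcE.
- apply: (bounded_stable_solution Tinv K0 c0 _ zsE) => n v vE.
  by have [h _] := hyp n w; exact: h.
Qed.
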